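(* Let $V$ be a simple real Jordan algebra of dimension $n$ and rank $r$. For $\lambda,\mu\in\mathbb C$ and $k\in\mathbb N$, $$b^{(k)}_{\lambda,\mu}(\xi,\zeta)=c^{(k)}_{\lambda-\frac nr,\,\mu-\frac nr}(\xi,\zeta).$$
   Context: $V$ is a simple real Jordan algebra with determinant polynomial $\det$ (of degree the rank $r$) and bilinear form $\tau(x,y)=\mathrm{tr}(xy)$. $V^*$ is the dual of $V$, with pairing $x.\xi$; for $\xi=\tau(\cdot,v)\in V^*$ put $\det\xi:=\det v$. For $\xi,\zeta\in V^*$, $\det(\frac{\partial}{\partial\xi}-\frac{\partial}{\partial\zeta})$ is the constant coefficient differential operator on $V^*\times V^*$ obtained by substituting $\frac{\partial}{\partial\xi}-\frac{\partial}{\partial\zeta}$ in the polynomial $\det$ on $V$, i.e. sending $e^{x.\xi+y.\zeta}$ to $\det(x-y)e^{x.\xi+y.\zeta}$; likewise $\det(\frac1i(\frac{\partial}{\partial\xi}-\frac{\partial}{\partial\zeta}))$ sends $e^{i(x.\xi+y.\zeta)}$ to $\det(x-y)e^{i(x.\xi+y.\zeta)}$. For $s\in\mathbb C$ and a sign $\epsilon\in\{\pm\}$, $t^{s,\epsilon}$ denotes $|t|^s$ if $\epsilon=+$ and $\mathrm{sgn}(t)|t|^s$ if $\epsilon=-$ ($t\in\mathbb R^*$). Powers written without a sign are taken on $\{\det\xi>0\}\times\{\det\zeta>0\}$; polynomial identities obtained there extend to $V^*\times V^*$. For $s,t\in\mathbb C$ and $k\in\mathbb N$, $c^{(k)}_{s,t}$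 is the unique polynomial on $V^*\times V^*$ such that $$\det\Big(\tfrac{\partial}{\partial\xi}-\tfrac{\partial}{\partial\zeta}\Big)^k(\det\xi^{s+k}\det\zeta^{t+k})=c^{(k)}_{s,t}(\xi,\zeta)\det\xi^s\det\zeta^t.$$ For generic $(s,\epsilon),(t,\eta)\in\mathbb C\times\{\pm\}$, $D_{s,t}$ is the differential operator with polynomial coefficients on $V^*\times V^*$ (it exists, and its coefficients are polynomial in $s,t$) such that $$\det\Big(\tfrac1i\big(\tfrac{\partial}{\partial\xi}-\tfrac{\partial}{\partial\zeta}\big)\Big)\circ(\det\xi^{s,\epsilon}\det\zeta^{t,\eta})=(\det\xi^{s-1,-\epsilon}\det\zeta^{t-1,-\eta})\circ D_{s,t},$$ where functions stand for multiplication operators. Its symbol $d_{s,t}$ is defined by $D_{s,t}(e^{i(x.\xi+y.\zeta)})=d_{s,t}(\xi,\zeta,x,y)e^{i(x.\xi+y.\zeta)}$. The source operator $F_{\lambda,\mu}$ is the differential operator with polynomial coefficients on $V\times V$ whose symbol $f_{\lambda,\mu}$, defined by $F_{\lambda,\mu}(e^{i(x.\xi+y.\zeta)})=f_{\lambda,\mu}(x,y,\xi,\zeta)e^{i(x.\xi+y.\zeta)}$, is normalized by $f_{\lambda,\mu}(x,y,\xi,\zeta)=d_{\lambda-\frac nr+1,\mu-\frac nr+1}(\xi,\zeta,x,y)$. Put $F^{(k)}_{\lambda,\mu}=F_{\lambda+k-1,\mu+k-1}\circ\dots\circ F_{\lambda,\mu}$ (with $F^{(0)}_{\lambda,\mu}=\mathrm{Id}$)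 and $B^{(k)}_{\lambda,\mu}=\mathrm{res}\circ F^{(k)}_{\lambda,\mu}$, where $\mathrm{res}(f)(x)=f(x,x)$. $B^{(k)}_{\lambda,\mu}$ has constant coefficients, and its symbol $b^{(k)}_{\lambda,\mu}(\xi,\zeta)$ is defined by $B^{(k)}_{\lambda,\mu}\big(e^{i(x.\xi+y.\zeta)}\big)(x)=b^{(k)}_{\lambda,\mu}(\xi,\zeta)e^{i(x.\xi+x.\zeta)}$.
   Formalization: The formal theorem states b = i^(-rk) c: with the given normalizations (D built from det((1/i)(∂ξ−∂ζ)), c from det(∂ξ−∂ζ)) the literal equality fails, e.g. V = R, k = 1 gives b = (1/i)(λζ−μξ) but c = λζ−μξ. *)

(* Defs.v *)
From HB Require Import structures.
From mathcomp Require Import all_boot all_order all_algebra complex.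
From mathcomp Require Import mpoly.
From mathcomp Require Import boolp classical_sets reals topology normedtype.
From mathcomp Require Import sequences derive exp trigo.

Set Implicit Arguments.
Unset Strict Implicit.
Unset Printing Implicit Defensive.
Import Order.TTheory GRing.Theory Num.Theory numFieldNormedType.Exports.
Local Open Scope ring_scope.
Local Open Scope complex_scope.

Record jordanAlgebra (R : realType) (n : nat) := JordanAlgebra {
  jmul : 'rV[R]_n -> 'rV[R]_n -> 'rV[R]_n;
  jone : 'rV[R]_n;
  jmul_linear : forall x, linear (jmul x);
  jmulC : commutative jmul;
  jmul_jordan : forall x y,
    jmul (jmul x x) (jmul x y) = jmul x (jmul (jmul x x) y);
  jmul1 : forall x, jmul jone x = x }.

Section Jordan.
Variables (R : realType) (n : nat) (J : jordanAlgebra R n).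

(* The algebra is unital, so its product is nonzero as soon as 0 < n. *)
Definition simple_jordan :=
  (0 < n)%N /\
  forall I : {vspace 'rV[R]_n},
    (forall x y, y \in I -> jmul J x y \in I) -> I = 0%VS \/ I = fullv.

Definition jpow (x : 'rV[R]_n) (k : nat) := iter k (jmul J x) (jone J).

Definition jhorner (p : {poly R}) (x : 'rV[R]_n) : 'rV[R]_n :=
  \sum_(i < size p) p`_i *: jpow x i.

Definition is_minpoly (x : 'rV[R]_n) (p : {poly R}) :=
  [/\ p \is monic, jhorner p x = 0 &
      forall q : {poly R}, q \is monic -> jhorner q x = 0 ->
        (size p <= size q)%N].

Definition has_rank (r : nat) :=
  (exists x p, is_minpoly x p /\ size p = r.+1) /\
  (forall x p, is_minpoly x p -> (size p <= r.+1)%N).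

Definition eval_at (p : {mpoly R[n]}) (x : 'rV[R]_n) : R := p.@[x 0].

(* The generic minimal polynomial: its coefficients are polynomial functions
   on V, and it specializes to the minimal polynomial of every regular x. *)
Definition is_generic_minpoly (r : nat) (m : {poly {mpoly R[n]}}) :=
  forall x p, is_minpoly x p -> size p = r.+1 ->
    map_poly (eval_at^~ x) m = p.

Variables (r : nat) (m : {poly {mpoly R[n]}}).

(* m = T^r - tr(x) T^(r-1) + ... + (-1)^r det(x) *)
Definition jdet : {mpoly R[n]} := (-1) ^+ r * m`_0.
Definition jtr : {mpoly R[n]} := - m`_r.-1.

Definition tau (x y : 'rV[R]_n) : R := eval_at jtr (jmul J x y).

Definition gram : 'M[R]_n :=
  \matrix_(i, j) tau (delta_mx 0 i) (delta_mx 0 j).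

(* V^* is identified with 'rV[R]_n through x.xi = \sum_i x_i xi_i, so that
   xi = tau(., v) reads xi = v *m gram. *)
Definition dual_det (xi : 'rV[R]_n) : R := eval_at jdet (xi *m invmx gram).

End Jordan.

Section Powers.
Variable R : realType.

Definition cis (theta : R) : R[i] := cos theta +i* sin theta.

(* t^s for t > 0 *)
Definition cpow (t : R) (s : R[i]) : R[i] :=
  (expR (complex.Re s * ln t))%:C * cis (complex.Im s * ln t).

(* t^(s,e) for t != 0; the boolean e is true for the sign +. *)
Definition spow (t : R) (s : R[i]) (e : bool) : R[i] :=
  (if e then 1 else (Num.sg t)%:C) * cpow `|t| s.

Definition dotp m (x y : 'rV[R]_m) : R := \sum_(i < m) x 0 i * y 0 i.

(* w |-> e^(i z.w) *)
Definition wave m (z w : 'rV[R]_m) : R[i] := cis (dotp z w).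

End Powers.

Section DiffOp.
Variables (R : realType) (m : nat).

Definition cfun := 'rV[R]_m -> R[i].

Definition pderiv (i : 'I_m) (f : cfun) : cfun := fun w =>
  'D_(delta_mx 0 i) (fun u => complex.Re (f u)) w +i*
  'D_(delta_mx 0 i) (fun u => complex.Im (f u)) w.

Definition smooth (f : cfun) :=
  forall (s : seq 'I_m) (w : 'rV[R]_m),
    differentiable (fun u => complex.Re (foldr pderiv f s u)) w /\
    differentiable (fun u => complex.Im (foldr pderiv f s u)) w.

Definition op_monom l (X : 'I_l -> cfun -> cfun) (a : 'X_{1..l})
  (f : cfun) : cfun :=
  foldr (fun i g => iter (a i) (X i) g) f (enum 'I_l).

Definition subst_op l (p : {mpoly R[l]}) (X : 'I_l -> cfun -> cfun)
  (f : cfun) : cfun := fun w =>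
  \sum_(a <- msupp p) (p@_a)%:C * op_monom X a f w.

(* The outer variables stand for the partial derivatives, and the coefficients
   are complex polynomials on R^m. *)
Definition weyl := {mpoly {mpoly R[i][m]}[m]}.

Definition diffop (P : weyl) (f : cfun) : cfun := fun w =>
  \sum_(a <- msupp P) (P@_a).@[fun i => (w 0 i)%:C] * op_monom pderiv a f w.

(* P (e^(i z.w)) = symbol P w z * e^(i z.w) *)
Definition symbol (P : weyl) (w z : 'rV[R]_m) : R[i] :=
  diffop P (wave z) w / wave z w.

End DiffOp.

(* V x V and V^* x V^* are identified with 'rV[R]_(n + n), the pair (xi, zeta)
   being row_mx xi zeta. *)
Section Source.
Variables (R : realType) (n : nat) (J : jordanAlgebra R n).
Variables (r : nat) (m : {poly {mpoly R[n]}}).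
Local Notation det := (jdet r m).
Local Notation ddet := (dual_det J r m).
Local Notation fn := (cfun R (n + n)).

Definition diff_deriv (i : 'I_n) (f : fn) : fn := fun w =>
  pderiv (lshift n i) f w - pderiv (rshift n i) f w.

Definition det_diff : fn -> fn := subst_op det diff_deriv.

Definition det_diff_i : fn -> fn :=
  subst_op det (fun i f w => ('i%C)^-1 * diff_deriv i f w).

Definition is_c (k : nat) (s t : R[i]) (c : {mpoly R[i][n + n]}) :=
  forall xi zeta : 'rV[R]_n, 0 < ddet xi -> 0 < ddet zeta ->
    iter k det_diff
      (fun w => cpow (ddet (lsubmx w)) (s + k%:R) *
                cpow (ddet (rsubmx w)) (t + k%:R)) (row_mx xi zeta) =
    c.@[fun i => (row_mx xi zeta 0 i)%:C] *
      (cpow (ddet xi) s * cpow (ddet zeta) t).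

Definition pt2 (s t : R[i]) : 'I_2 -> R[i] := tnth [tuple s; t].

Definition polynomial_family (D : R[i] -> R[i] -> weyl R (n + n)) :=
  exists P : {mpoly {mpoly {mpoly R[i][2]}[n + n]}[n + n]},
    forall s t, D s t = map_mpoly (map_mpoly (meval (pt2 s t))) P.

(* Zariski density, the weakest meaning of "for generic (s, t)" *)
Definition generic_set (G : R[i] -> R[i] -> Prop) :=
  forall q : {mpoly R[i][2]},
    (forall s t, G s t -> q.@[pt2 s t] = 0) -> q = 0.

Definition is_D (D : R[i] -> R[i] -> weyl R (n + n)) :=
  polynomial_family D /\
  forall e h : bool, exists2 G, generic_set G &
    forall s t, G s t -> forall phi : fn, smooth phi ->
    forall xi zeta : 'rV[R]_n, ddet xi != 0 -> ddet zeta != 0 ->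
      det_diff_i
        (fun w => spow (ddet (lsubmx w)) s e * spow (ddet (rsubmx w)) t h *
                  phi w) (row_mx xi zeta) =
      spow (ddet xi) (s - 1) (~~ e) * spow (ddet zeta) (t - 1) (~~ h) *
        diffop (D s t) phi (row_mx xi zeta).

Definition n_over_r : R[i] := n%:R / r%:R.

Definition is_source (D F : R[i] -> R[i] -> weyl R (n + n)) :=
  forall (lambda mu : R[i]) (x y xi zeta : 'rV[R]_n),
    symbol (F lambda mu) (row_mx x y) (row_mx xi zeta) =
    symbol (D (lambda - n_over_r + 1) (mu - n_over_r + 1))
      (row_mx xi zeta) (row_mx x y).

Fixpoint source_iter (F : R[i] -> R[i] -> weyl R (n + n)) (k : nat)
  (lambda mu : R[i]) (f : fn) : fn :=
  if k is k'.+1 then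
    diffop (F (lambda + k'%:R) (mu + k'%:R)) (source_iter F k' lambda mu f)
  else f.

Definition bidiff F (k : nat) (lambda mu : R[i]) (f : fn) : cfun R n :=
  fun x => source_iter F k lambda mu f (row_mx x x).

(* D, hence F and b, is built from det((1/i)(d/dxi - d/dzeta)), whereas c is
   built from det(d/dxi - d/dzeta); since det is homogeneous of degree r, the
   two normalizations differ by the factor i^(-rk). *)
Definition is_b F (k : nat) (lambda mu : R[i])
  (b : 'rV[R]_n -> 'rV[R]_n -> R[i]) :=
  forall x xi zeta : 'rV[R]_n,
    bidiff F k lambda mu (wave (row_mx xi zeta)) x =
    b xi zeta * wave (row_mx xi zeta) (row_mx x x).

End Source.

(* Main.v *)
From HB Require Import structures.
Require Import Defs.
From mathcomp Require Import all_boot all_order all_algebra complex.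
From mathcomp Require Import mpoly.
From mathcomp Require Import boolp classical_sets functions reals topology normedtype.
From mathcomp Require Import sequences derive exp trigo.
From mathcomp Require Import ring lra.

(** Write z = (xi, zeta). The number b(xi, zeta) is read off at x = 0, where it is the
    value at w = 0 of F_(k-1) ... F_0 applied to w |-> e^(i w.z), with
    F_j = F_(lambda+j, mu+j).

    The normalization of the source operators says that F_j in the variable w and
    D_j = D_(lambda+j-n/r+1, mu+j-n/r+1) in the variable z give the same result on the
    kernel e^(i w.z). Operators in w commute with operators in z, so
      F_(k-1) ... F_0 e^(i w.z) = D_0 ... D_(k-1) e^(i w.z),
    and at w = 0 this is (D_0 ... D_(k-1) 1)(z). This is [symbol_duality]; it is proved
    with polynomials h(w, z), which stand for h(w, z) e^(i w.z), so that the exchange of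
    derivatives is an algebraic identity.

    On the other hand, the relation which defines D_(s,t) holds for generic (s, t). On
    the open set where both determinants are positive, its two sides are, up to the
    factor det(xi)^s det(zeta)^t, polynomial in (s, t) for a fixed polynomial test
    function; hence it holds for all (s, t) ([intertwining_extend]). Iterating it from
    the exponents s + k, t + k, with s = lambda - n/r and t = mu - n/r, gives
      det((d/dxi - d/dzeta)/i)^k (det(xi)^(s+k) det(zeta)^(t+k))
        = det(xi)^s det(zeta)^t D_0 ... D_(k-1) 1
    ([intertwining_iter]). Since det is homogeneous of degree r, the left-hand side is
    i^(-rk) c(xi, zeta) det(xi)^s det(zeta)^t. The two polynomials i^(-rk) c and
    D_0 ... D_(k-1) 1 therefore agree on that open set, hence everywhere
    ([poly_open_eq0]).

    The structure of Jordan algebras enters in two places. The homogeneity of det comes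
    from the uniqueness of minimal polynomials and the density of regular elements.
    That the open set is not empty requires the form tau to be nondegenerate; then the
    determinant of the linear form tau(., e) is det(e) = 1. The form tau is associative
    because commutators of multiplications are derivations and derivations have trace
    zero ([jtr_derivation]), so its radical is an ideal; it does not contain e, because
    tr(e) = r, and the algebra is simple ([gram_unit]). *)

Set Implicit Arguments.
Unset Strict Implicit.
Unset Printing Implicit Defensive.
Import Order.TTheory GRing.Theory Num.Theory numFieldNormedType.Exports.
Local Open Scope ring_scope.
Local Open Scope complex_scope.

(** Identities between polynomials that are compatible with sums and products
    need to be checked on constants and variables only. *)
Lemma mpoly_closure (l : nat) (K : comNzRingType) (P : {mpoly K[l]} -> Prop) :
  (forall c, P c%:MP) -> (forall i, P 'X_i) ->
  (forall p q, P p -> P q -> P (p + q)) ->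
  (forall p q, P p -> P q -> P (p * q)) -> forall p, P p.
Proof.
move=> PC PX PD PM p; rewrite [p]mpolyE.
apply: (big_ind P) => [|x y|a _]; [by rewrite -mpolyC0|exact: PD|].
rewrite -mul_mpolyC; apply: (PM) => //; rewrite mpolyXE_id.
apply: (big_ind P) => [|x y|i _]; [by rewrite -mpolyC1|exact: PM|].
by elim: (a i) => [|k ih]; rewrite ?expr0 -?mpolyC1 // exprS; apply: (PM).
Qed.

Lemma mderivXU (l : nat) (K : nzRingType) (i j : 'I_l) :
  ('X_i : {mpoly K[l]})^`M(j) = (i == j)%:R.
Proof.
rewrite mderivX mnm1E; case: eqP => [->|_]; last by rewrite scale0r.
by rewrite -{1}[U_(j)%MM]addm0 addmC addmK mpolyX0 scale1r.
Qed.

(** * Partial derivatives of complex valued functions *)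

Section Calculus.
Variables (R : realType).

(** The one-variable chain rule along the line through [w] with direction [v]. *)
Lemma is_derive_chain (V : normedModType R) (f : V -> R) (g : R -> R)
    (w v : V) (df dg : R) :
  is_derive w v f df -> is_derive (f w) (1 : R) g dg ->
  is_derive w v (fun u => g (f u)) (dg * df).
Proof.
move=> [df1 df2] [dg1 dg2].
pose l (h : R) : R := f (h *: v + w).
have l0 : l 0 = f w by rewrite /l scale0r add0r.
have dl : derivable l 0 1 := (derivable1P f w v).1 df1.
have line (F : V -> R) : 'D_v F w = (fun h : R => F (h *: v + w))^`()%classic 0.
  rewrite /derive1 /derive; set g1 := fun h => h^-1 *: _; set g2 := fun h => h^-1 *: _.
  suff -> : g1 = g2 by [].
  by apply/funext => h; rewrite /g1 /g2 /= addr0 scale0r add0r.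
have dg' : derivable g (l 0) 1 by rewrite l0.
have dgl : derivable (g \o l) 0 1.
  by apply/derivable1_diffP/differentiable_comp; apply/derivable1_diffP.
apply: DeriveDef; first exact: (derivable1P _ w v).2 dgl.
rewrite line; apply: etrans (derive1_comp dl dg') _.
by rewrite l0 derive1E dg2 -line df2.
Qed.

Variable m : nat.
Implicit Types (f g : cfun R m) (w : 'rV[R]_m) (j : 'I_m).

(** Unlike [pderiv], whose value at a point where the limit does not exist is a
    junk value, this predicate carries differentiability, so that it obeys the
    rules of calculus without side conditions. *)
Definition has_pd f j w (d : R[i]) :=
  is_derive w (delta_mx 0 j) (fun u => complex.Re (f u)) (complex.Re d) /\
  is_derive w (delta_mx 0 j) (fun u => complex.Im (f u)) (complex.Im d).

Lemma has_pdE f j w d : has_pd f j w d -> pderiv j f w = d.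
Proof. by case: d => a b [[_ /= h1] [_ /= h2]]; rewrite /pderiv h1 h2. Qed.

Lemma has_pd_uniq f j w d1 d2 : has_pd f j w d1 -> has_pd f j w d2 -> d1 = d2.
Proof. by move=> /has_pdE <- /has_pdE. Qed.

Lemma near_has_pd f g j w d :
  (\near w, f w = g w) -> has_pd f j w d -> has_pd g j w d.
Proof.
move=> fg [h1 h2]; split; [apply: near_eq_is_derive h1|apply: near_eq_is_derive h2];
by apply: filterS fg => u ->.
Qed.

Lemma near_pderiv f g j w :
  (\near w, f w = g w) -> pderiv j f w = pderiv j g w.
Proof.
move=> fg; rewrite /pderiv; congr (_ +i* _); apply: near_eq_derive;
by apply: filterS fg => u ->.
Qed.

Lemma has_pd_cst (c : R[i]) j w : has_pd (fun=> c) j w 0.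
Proof. by split; apply: is_derive_cst. Qed.

Lemma has_pdD f g j w df dg : has_pd f j w df -> has_pd g j w dg ->
  has_pd (fun u => f u + g u) j w (df + dg).
Proof.
case: df dg => [a b] [a' b'] [h1 h2] [h3 h4]; split.
  have := is_deriveD h1 h3; congr is_derive; apply/funext => u /=.
  by rewrite fctE; case: (f u) (g u) => ? ? [? ?].
have := is_deriveD h2 h4; congr is_derive; apply/funext => u /=.
by rewrite fctE; case: (f u) (g u) => ? ? [? ?].
Qed.

Lemma has_pdM f g j w df dg : has_pd f j w df -> has_pd g j w dg ->
  has_pd (fun u => f u * g u) j w (df * g w + f w * dg).
Proof.
case: df dg => [a b] [a' b'] [h1 h2] [h3 h4]; split.
  have := is_deriveB (is_deriveM h1 h3) (is_deriveM h2 h4).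
  have -> : (fun u => complex.Re (f u)) * (fun u => complex.Re (g u)) -
     (fun u => complex.Im (f u)) * (fun u => complex.Im (g u)) =
     (fun u => complex.Re (f u * g u)).
    by apply/funext => u; rewrite !fctE; case: (f u) (g u) => ? ? [? ?].
  move=> h; apply: (is_derive_eq h); rewrite /GRing.scale /=.
  by case: (f w) (g w) => ? ? [? ?] /=; ring.
have := is_deriveD (is_deriveM h1 h4) (is_deriveM h2 h3).
have -> : (fun u => complex.Re (f u)) * (fun u => complex.Im (g u)) +
     (fun u => complex.Im (f u)) * (fun u => complex.Re (g u)) =
     (fun u => complex.Im (f u * g u)).
  apply/funext => u; rewrite !fctE; case: (f u) (g u) => ? ? [? ?] /=; ring.
move=> h; apply: (is_derive_eq h); rewrite /GRing.scale /=.
by case: (f w) (g w) => ? ? [? ?] /=; ring.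
Qed.

Lemma has_pdZ (c : R[i]) f j w d : has_pd f j w d ->
  has_pd (fun u => c * f u) j w (c * d).
Proof.
move=> h; have := has_pdM (has_pd_cst c j w) h.
by rewrite mul0r add0r.
Qed.

Lemma has_pd_coord i j w : has_pd (fun u => (u 0 i)%:C) j w (i == j)%:R.
Proof.
have -> : ((i == j)%:R : R[i]) = ((i == j)%:R)%:C by case: (i == j).
split; last exact: is_derive_cst.
have h : differentiable (fun u : 'rV[R]_m => u 0 i : R) w
  by apply: differentiable_coord.
apply: DeriveDef; first exact: diff_derivable.
have -> : (complex.Re ((i == j)%:R)%:C : R) = (i == j)%:R by [].
have /matrixP/(_ 0 i) := derive_mx (@derivable_id _ _ w (delta_mx 0 j)).
by rewrite derive_id !mxE eqxx /= => <-.
Qed.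

(** One rule for polynomials in w alone and for polynomials in w and further
    parameters, such as a second vector or a pair of exponents. *)
Lemma has_pd_meval l (v : 'rV[R]_m -> 'I_l -> R[i]) (p : {mpoly R[i][l]})
    j w (s : 'I_l) :
  (forall i, has_pd (fun u => v u i) j w (i == s)%:R) ->
  has_pd (fun u => p.@[v u]) j w (p^`M(s)).@[v w].
Proof.
move=> hv; elim/mpoly_closure: p => [c|i|p q hp hq|p q hp hq].
- rewrite mderivC meval0; apply: near_has_pd (has_pd_cst c _ _).
  by near=> u; rewrite mevalC.
- have -> : ('X_i^`M(s)).@[v w] = (i == s)%:R.
    by rewrite mderivXU; case: eqP => _; rewrite ?meval1 ?meval0.
  by apply: near_has_pd (hv i); near=> u; rewrite mevalXU.
- rewrite mderivD mevalD; apply: near_has_pd (has_pdD hp hq).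
  by near=> u; rewrite mevalD.
- rewrite mderivM mevalD !mevalM; apply: near_has_pd (has_pdM hp hq).
  by near=> u; rewrite mevalM.
Unshelve. all: by end_near.
Qed.

Definition ptC (w : 'rV[R]_m) : 'I_m -> R[i] := fun i => (w 0 i)%:C.

Lemma has_pd_poly (p : {mpoly R[i][m]}) j w :
  has_pd (fun u => p.@[ptC u]) j w (p^`M(j)).@[ptC w].
Proof. by apply: has_pd_meval => i; apply: has_pd_coord. Qed.

Lemma pderiv_poly (p : {mpoly R[i][m]}) j :
  pderiv j (fun u => p.@[ptC u]) = fun u => (p^`M(j)).@[ptC u].
Proof. by apply/funext => w; apply/has_pdE/has_pd_poly. Qed.

Lemma differentiable_poly (p : {mpoly R[i][m]}) w :
  differentiable (fun u => complex.Re p.@[ptC u]) w /\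
  differentiable (fun u => complex.Im p.@[ptC u]) w.
Proof.
elim/mpoly_closure: p => [c|i|p q [h1 h2] [h3 h4]|p q [h1 h2] [h3 h4]].
- split.
    have -> : (fun u : 'rV[R]_m => complex.Re (c%:MP.@[ptC u])) = cst (complex.Re c).
      by apply/funext => u; rewrite mevalC.
    exact: differentiable_cst.
  have -> : (fun u : 'rV[R]_m => complex.Im (c%:MP.@[ptC u])) = cst (complex.Im c).
    by apply/funext => u; rewrite mevalC.
  exact: differentiable_cst.
- split.
    have -> : (fun u : 'rV[R]_m => complex.Re (('X_i).@[ptC u])) = (fun u => u 0 i).
      by apply/funext => u; rewrite mevalXU.
    exact: differentiable_coord.
  have -> : (fun u : 'rV[R]_m => complex.Im (('X_i).@[ptC u])) = cst 0.
    by apply/funext => u; rewrite mevalXU.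
  exact: differentiable_cst.
- split.
    have -> : (fun u => complex.Re (p + q).@[ptC u]) =
        (fun u => complex.Re p.@[ptC u]) + (fun u => complex.Re q.@[ptC u]).
      by apply/funext => u; rewrite fctE mevalD raddfD.
    exact: differentiableD.
  have -> : (fun u => complex.Im (p + q).@[ptC u]) =
      (fun u => complex.Im p.@[ptC u]) + (fun u => complex.Im q.@[ptC u]).
    by apply/funext => u; rewrite fctE mevalD raddfD.
  exact: differentiableD.
- split.
    have -> : (fun u => complex.Re (p * q).@[ptC u]) =
        (fun u => complex.Re p.@[ptC u]) * (fun u => complex.Re q.@[ptC u]) -
        (fun u => complex.Im p.@[ptC u]) * (fun u => complex.Im q.@[ptC u]).
      apply/funext => u; rewrite !fctE mevalM.
      by case: (p.@[_]) (q.@[_]) => ? ? [? ?].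
    by apply: differentiableB; apply: differentiableM.
  have -> : (fun u => complex.Im (p * q).@[ptC u]) =
      (fun u => complex.Re p.@[ptC u]) * (fun u => complex.Im q.@[ptC u]) +
      (fun u => complex.Im p.@[ptC u]) * (fun u => complex.Re q.@[ptC u]).
    apply/funext => u; rewrite !fctE mevalM.
    by case: (p.@[_]) (q.@[_]) => ? ? [? ?] /=; ring.
  by apply: differentiableD; apply: differentiableM.
Qed.

Lemma smooth_poly (p : {mpoly R[i][m]}) : smooth (fun u => p.@[ptC u]).
Proof.
move=> s w.
have [q ->] : exists q : {mpoly R[i][m]},
    foldr (@pderiv R m) (fun u => p.@[ptC u]) s = fun u => q.@[ptC u].
  elim: s => [|j s [q /= ->]]; first by exists p.
  by exists q^`M(j); rewrite pderiv_poly.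
exact: differentiable_poly.
Qed.

End Calculus.

(** * Waves and complex powers *)

Section Exponentials.
Variables (R : realType) (m : nat).
Implicit Types (w z : 'rV[R]_m) (j : 'I_m).

(** By induction on the degree: the partial derivatives also vanish on [U] and have
    smaller degree, so they are zero and the polynomial is constant. *)
Lemma poly_open_eq0 (U : set 'rV[R]_m) (p : {mpoly R[i][m]}) :
  open U -> (exists w, U w) -> (forall w, U w -> p.@[ptC w] = 0) -> p = 0.
Proof.
move=> oU [w0 U0]; elim: {p}(msize p) {-2}p (leqnn (msize p)) => [|k ih] p sp pU.
  by apply/eqP; rewrite -msize_poly_eq0 -leqn0.
have dp j : p^`M(j) = 0.
  apply: ih => [|w Uw].
    rewrite msizeE; apply/bigmax_leqP_seq => a ap _.
    have : (a + U_(j))%MM \in msupp p.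
      move: ap; rewrite !mcoeff_msupp mcoeff_deriv; apply: contra => /eqP ->.
      by rewrite mul0rn.
    by move=> /msize_mdeg_lt /leq_trans /(_ sp); rewrite mdegD mdeg1 addn1.
  apply: (has_pd_uniq (has_pd_poly p j w)).
  apply: near_has_pd (has_pd_cst 0 j w).
  by move: (open_nbhs_nbhs (conj oU Uw)); apply: filterS => u /pU.
have pC : p = (p@_0)%:MP.
  apply/mpolyP => a; rewrite mcoeffC; have [->|a0] := eqVneq 0%MM a.
    by rewrite mulr1.
  rewrite mulr0; have [j aj] : exists j, a j != 0%N.
    apply/existsP; apply: contraNT a0; rewrite negb_exists => /forallP h.
    by apply/eqP/mnmP => j; rewrite mnm0E; have := h j; rewrite negbK => /eqP.
  have ja : (U_(j) <= a)%MM by rewrite lep1mP.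
  have := congr1 (fun q => q@_(a - U_(j))) (dp j).
  rewrite /= mcoeff0 mcoeff_deriv submK // => /eqP.
  by rewrite mulrn_eq0 /= => /eqP->.
by move: (pU _ U0); rewrite pC mevalC => ->; rewrite mpolyC0.
Qed.

Lemma has_pd_real (f : 'rV[R]_m -> R) j w (d : R) :
  is_derive w (delta_mx 0 j) f d <-> has_pd (fun u => (f u)%:C) j w d%:C.
Proof. by split=> [h|[]//]; split=> //=; apply: is_derive_cst. Qed.

Lemma has_pd_cis (f : 'rV[R]_m -> R) j w (d : R) :
  is_derive w (delta_mx 0 j) f d ->
  has_pd (fun u => cis (f u)) j w ('i * d%:C * cis (f w)).
Proof.
move=> h; split; rewrite /cis /=.
  apply: (is_derive_eq (is_derive_chain h (is_derive_cos _))); ring.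
apply: (is_derive_eq (is_derive_chain h (is_derive_sin _))); ring.
Qed.

Lemma has_pd_cpow (f : 'rV[R]_m -> R) j w (d : R) (s : R[i]) : 0 < f w ->
  is_derive w (delta_mx 0 j) f d ->
  has_pd (fun u => cpow (f u) s) j w (s * (d / f w)%:C * cpow (f w) s).
Proof.
move=> fw h.
have hln := is_derive_chain h (is_derive1_ln fw).
have hlin (a : R) : is_derive w (delta_mx 0 j) (fun u => a * ln (f u)) (a * (d / f w)).
  apply: (is_derive_eq (is_deriveZ a hln)).
  by rewrite [_^-1 * d]mulrC.
have hexp := is_derive_chain (hlin (complex.Re s)) (is_derive_expR _).
have := has_pdM (proj1 (has_pd_real _ _ _ _) hexp) (has_pd_cis (hlin (complex.Im s))).
rewrite /cpow; congr has_pd.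
case: s {hlin hexp} => a b /=; set e := expR _; set c := cis _.
have -> : (a +i* b) = a%:C + 'i * b%:C by simpc.
by rewrite !rmorphM; ring.
Qed.

Lemma dotp_poly z w : (dotp z w)%:C = (\sum_i (z 0 i)%:C *: 'X_i).@[ptC w].
Proof.
rewrite raddf_sum rmorph_sum /=; apply: eq_bigr => i _.
by rewrite mevalZ mevalXU rmorphM.
Qed.

Lemma dotpC z w : dotp z w = dotp w z.
Proof. by apply: eq_bigr => i _; rewrite mulrC. Qed.

Lemma waveC z w : wave z w = wave w z.
Proof. by rewrite /wave dotpC. Qed.

Lemma wave0 z : wave z 0 = 1.
Proof.
rewrite /wave /dotp big1 => [|i _]; last by rewrite mxE mulr0.
by rewrite /cis cos0 sin0.
Qed.

Lemma wave_neq0 z w : wave z w != 0.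
Proof.
rewrite /wave; move: (dotp z w) => t; apply/eqP => /eqP.
rewrite eq_complex /= => /andP [/eqP c0 /eqP s0].
have := cos2Dsin2 t; rewrite c0 s0 expr0n addr0 => /eqP.
by rewrite eq_sym oner_eq0.
Qed.

Lemma has_pd_wave z j w : has_pd (wave z) j w ('i * (z 0 j)%:C * wave z w).
Proof.
apply: has_pd_cis; apply/has_pd_real.
have := has_pd_poly (\sum_i (z 0 i)%:C *: 'X_i) j w.
have -> : ((\sum_i (z 0 i)%:C *: 'X_i)^`M(j)).@[ptC w] = (z 0 j)%:C.
  rewrite (raddf_sum (mderiv j)) (raddf_sum (meval _)) (bigD1 j) //= big1 ?addr0 => [|i /negbTE ij].
    by rewrite mderivZ mevalZ mderivXU eqxx meval1 mulr1.
  by rewrite mderivZ mevalZ mderivXU ij meval0 mulr0.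
by apply: near_has_pd; near=> u; rewrite dotp_poly.
Unshelve. all: by end_near.
Qed.

Lemma cpowD (t : R) (s s' : R[i]) : cpow t (s + s') = cpow t s * cpow t s'.
Proof.
case: s s' => a b [a' b']; rewrite /cpow /cis /= !mulrDl expRD cosD sinD.
by simpc; congr (_ +i* _); ring.
Qed.

Lemma cpow_neq0 (t : R) (s : R[i]) : cpow t s != 0.
Proof.
rewrite mulf_neq0 //; first by rewrite -[0]/(0%:C) (inj_eq (@complexI _)) gt_eqF ?expR_gt0.
apply/eqP => /eqP; rewrite eq_complex /= => /andP [/eqP c0 /eqP s0].
have := cos2Dsin2 (complex.Im s * ln t); rewrite c0 s0 expr0n addr0 => /eqP.
by rewrite eq_sym oner_eq0.
Qed.

Lemma cpow1 (t : R) : 0 < t -> cpow t 1 = t%:C.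
Proof.
move=> t0; rewrite /cpow /cis /= mul0r cos0 sin0 mul1r lnK ?posrE //.
exact: mulr1.
Qed.

Lemma cpowB1 (t : R) (s : R[i]) : 0 < t -> cpow t (s - 1) = cpow t s / t%:C.
Proof.
move=> t0; have t0' : t%:C != 0 by rewrite -[0]/(0%:C) (inj_eq (@complexI _)) gt_eqF.
apply: (mulIf t0').
by rewrite divfK // -(cpow1 t0) -cpowD subrK.
Qed.

End Exponentials.

(** * The duality between an operator and the operator with transposed symbol *)

Section WeylDuality.
Variables (K : comNzRingType) (m : nat) (I : K).
(* A polynomial h(w, z) stands for the function h(w, z) e^(i w.z) of two vectors;
   the w are the left variables, the z are the right ones, and I is the
   imaginary unit. *)
Local Notation E := {mpoly K[m + m]}.

Section Action.
Variables (X : 'I_m -> E -> E) (iota : {mpoly K[m]} -> E).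

Definition monom_act (a : 'X_{1..m}) (h : E) : E :=
  foldr (fun i g => iter (a i) (X i) g) h (enum 'I_m).

(** The operator [P] acts with its coefficients embedded by [iota] and its partial
    derivatives replaced by the operators [X]. *)
Definition weyl_act (P : {mpoly {mpoly K[m]}[m]}) (h : E) : E :=
  \sum_(a <- msupp P) iota P@_a * monom_act a h.

Lemma monom_act_comm (T : E -> E) a h :
  (forall i g, T (X i g) = X i (T g)) -> T (monom_act a h) = monom_act a (T h).
Proof.
move=> TX; rewrite /monom_act; elim: (enum _) => //= i s <-.
by elim: (a i) => //= k <-.
Qed.

Lemma weyl_act_comm (T : E -> E) P h :
  (forall g g', T (g + g') = T g + T g') -> (forall p g, T (iota p * g) = iota p * T g) ->
  (forall i g, T (X i g) = X i (T g)) -> T (weyl_act P h) = weyl_act P (T h).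
Proof.
move=> TD TM TX; rewrite /weyl_act.
have T0 : T 0 = 0 by apply: (addrI (T 0)); rewrite -TD !addr0.
rewrite (big_morph T TD T0); apply: eq_bigr => a _.
by rewrite TM monom_act_comm.
Qed.

Lemma weyl_actD P g h : (forall i f f', X i (f + f') = X i f + X i f') ->
  weyl_act P (g + h) = weyl_act P g + weyl_act P h.
Proof.
move=> XD; rewrite /weyl_act -big_split /=; apply: eq_bigr => a _.
rewrite -mulrDr; congr (_ * _); rewrite /monom_act.
elim: (enum _) => //= i s ->.
by elim: (a i) => //= k ->.
Qed.
End Action.

Definition lvars (p : {mpoly K[m]}) : E := p \mPo [tuple 'X_(lshift m i) | i < m].
Definition rvars (p : {mpoly K[m]}) : E := p \mPo [tuple 'X_(rshift m i) | i < m].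

(** [lder] and [rder] are the partial derivatives in w and in z, conjugated by
    e^(i w.z). *)
Definition lder (i : 'I_m) (h : E) : E :=
  h^`M(lshift m i) + I *: ('X_(rshift m i) * h).
Definition rder (i : 'I_m) (h : E) : E :=
  h^`M(rshift m i) + I *: ('X_(lshift m i) * h).

Lemma mderiv_lvars p i : (lvars p)^`M(rshift m i) = 0.
Proof.
rewrite /lvars; elim/mpoly_closure: p => [c|j|p q hp hq|p q hp hq].
- by rewrite comp_mpolyC mderivC.
- by rewrite comp_mpolyXU -tnth_nth tnth_mktuple mderivXU eq_lrshift.
- rewrite comp_mpolyD; move: (comp_mpoly _ p) (comp_mpoly _ q) hp hq => P Q hp hq.
  by rewrite mderivD hp hq addr0.
- rewrite rmorphM /=; move: (comp_mpoly _ p) (comp_mpoly _ q) hp hq => P Q hp hq.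
  by rewrite mderivM hp hq mul0r mulr0 addr0.
Qed.

Lemma mderiv_rvars p i : (rvars p)^`M(lshift m i) = 0.
Proof.
rewrite /rvars; elim/mpoly_closure: p => [c|j|p q hp hq|p q hp hq].
- by rewrite comp_mpolyC mderivC.
- by rewrite comp_mpolyXU -tnth_nth tnth_mktuple mderivXU eq_rlshift.
- rewrite comp_mpolyD; move: (comp_mpoly _ p) (comp_mpoly _ q) hp hq => P Q hp hq.
  by rewrite mderivD hp hq addr0.
- rewrite rmorphM /=; move: (comp_mpoly _ p) (comp_mpoly _ q) hp hq => P Q hp hq.
  by rewrite mderivM hp hq mul0r mulr0 addr0.
Qed.

Lemma lderD i : {morph lder i : g h / g + h}.
Proof. by move=> g h; rewrite /lder mderivD mulrDr scalerDr addrACA. Qed.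

Lemma rderD i : {morph rder i : g h / g + h}.
Proof. by move=> g h; rewrite /rder mderivD mulrDr scalerDr addrACA. Qed.

Lemma lder_rvars i p h : lder i (rvars p * h) = rvars p * lder i h.
Proof.
rewrite /lder mderivM mderiv_rvars mul0r add0r mulrDr; congr (_ + _).
by rewrite mulrCA -scalerAr.
Qed.

Lemma rder_lvars i p h : rder i (lvars p * h) = lvars p * rder i h.
Proof.
rewrite /rder mderivM mderiv_lvars mul0r add0r mulrDr; congr (_ + _).
by rewrite mulrCA -scalerAr.
Qed.

(** Both mixed terms [i delta_(i,j)] come from the same function e^(i w.z); this is
    Schwarz's theorem for h(w, z) e^(i w.z). *)
Lemma lder_rder i j h : lder i (rder j h) = rder j (lder i h).
Proof.
have e1 : 'X_(lshift m j)^`M(lshift m i) = (i == j)%:R :> E.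
  by rewrite mderivXU (inj_eq (@lshift_inj _ _)) eq_sym.
have e2 : 'X_(rshift m i)^`M(rshift m j) = (i == j)%:R :> E.
  by rewrite mderivXU (inj_eq (@rshift_inj _ _)).
have e3 := mderiv_comm (lshift m i) (rshift m j) h.
have mDX k (x g : E) : (g + I *: (x * h))^`M(k) = g^`M(k) + I *: (x^`M(k) * h + x * h^`M(k)).
  by rewrite mderivD mderivZ mderivM.
rewrite /lder /rder (mDX (lshift m i)) (mDX (rshift m j)) e1 e2 {}e3.
move: (h^`M(lshift m i)) (h^`M(rshift m j)) => g1 g2.
move: (g2^`M(_)) ('X_(rshift m i) : E) ('X_(lshift m j) : E) ((i == j)%:R : E) => g3 x y d.
clear e1 e2 mDX; rewrite -!mul_mpolyC; move: (mpolyC _ _) h g1 g2 g3 x y d => J h g1 g2 g3 x y d.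
ring.
Qed.

Definition lact := weyl_act lder lvars.
Definition ract := weyl_act rder rvars.

(** The variables and the twisted derivatives of the two sides commute pairwise. *)
Lemma lact_ract P Q h : lact P (ract Q h) = ract Q (lact P h).
Proof.
apply: weyl_act_comm => [g g'|p g|i g].
- by apply: weyl_actD => i; apply: lderD.
- apply/esym/weyl_act_comm => [f f'|q f|i f]; first exact: mulrDr.
  + exact: mulrCA.
  + by rewrite lder_rvars.
- apply/esym/weyl_act_comm => [f f'|q f|j f]; first exact: rderD.
  + exact: rder_lvars.
  + by rewrite lder_rder.
Qed.

Fixpoint lact_iter (F : nat -> {mpoly {mpoly K[m]}[m]}) k : E :=
  if k is k'.+1 then lact (F k') (lact_iter F k') else 1.

Fixpoint ract_iter (D : nat -> {mpoly {mpoly K[m]}[m]}) k (h : E) : E :=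
  if k is k'.+1 then ract_iter D k' (ract (D k') h) else h.

(** Composition is reversed by the duality: since F_j 1 = D_j 1,
    F_1 F_0 1 = F_1 D_0 1 = D_0 F_1 1 = D_0 D_1 1, and so on. *)
Lemma lact_iterE (D F : nat -> {mpoly {mpoly K[m]}[m]}) k :
  (forall j, lact (F j) 1 = ract (D j) 1) -> lact_iter F k = ract_iter D k 1.
Proof.
move=> FD; have comm P i h : lact P (ract_iter D i h) = ract_iter D i (lact P h).
  by elim: i h => [//|i ih] h /=; rewrite ih lact_ract.
by elim: k => [//|k ih] /=; rewrite ih comm FD.
Qed.

End WeylDuality.

Section Duality.
Variables (R : realType) (m : nat).
Local Notation C := R[i].
Local Notation E := {mpoly C[m + m]}.
Local Notation lder := (@lder C m 'i).
Local Notation rder := (@rder C m 'i).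
Local Notation lact := (@lact C m 'i).
Local Notation ract := (@ract C m 'i).

Definition wval (w z : 'rV[R]_m) (h : E) : C := h.@[ptC (row_mx w z)].

Lemma wval_lvars w z p : wval w z (lvars p) = p.@[ptC w].
Proof.
rewrite /wval comp_mpoly_meval; apply: meval_eq => i.
by rewrite tnth_mktuple mevalXU /ptC row_mxEl.
Qed.

Lemma wval_rvars w z p : wval w z (rvars p) = p.@[ptC z].
Proof.
rewrite /wval comp_mpoly_meval; apply: meval_eq => i.
by rewrite tnth_mktuple mevalXU /ptC row_mxEr.
Qed.

Lemma has_pd_lder (h : E) z i w :
  has_pd (fun u => wval u z h * wave z u) i w (wval w z (lder i h) * wave z w).
Proof.
have -> : wval w z (lder i h) * wave z w =
    wval w z h^`M(lshift m i) * wave z w + wval w z h * ('i * (z 0 i)%:C * wave z w).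
  by rewrite /wval mevalD mevalZ mevalM mevalXU /ptC row_mxEr; ring.
apply: has_pdM (has_pd_wave z i w).
apply: has_pd_meval => k; rewrite /ptC; case: (split_ordP k) => j ->.
  rewrite (inj_eq (@lshift_inj _ _)); apply: near_has_pd (has_pd_coord j i w).
  by near=> u; rewrite row_mxEl.
rewrite eq_rlshift; apply: near_has_pd (has_pd_cst (z 0 j)%:C i w).
by near=> u; rewrite row_mxEr.
Unshelve. all: by end_near.
Qed.

Lemma has_pd_rder (h : E) w i z :
  has_pd (fun u => wval w u h * wave w u) i z (wval w z (rder i h) * wave w z).
Proof.
have -> : wval w z (rder i h) * wave w z =
    wval w z h^`M(rshift m i) * wave w z + wval w z h * ('i * (w 0 i)%:C * wave w z).
  by rewrite /wval mevalD mevalZ mevalM mevalXU /ptC row_mxEl; ring.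
apply: has_pdM (has_pd_wave w i z).
apply: has_pd_meval => k; rewrite /ptC; case: (split_ordP k) => j ->.
  rewrite eq_lrshift; apply: near_has_pd (has_pd_cst (w 0 j)%:C i z).
  by near=> u; rewrite row_mxEl.
rewrite (inj_eq (@rshift_inj _ _)); apply: near_has_pd (has_pd_coord j i z).
by near=> u; rewrite row_mxEr.
Unshelve. all: by end_near.
Qed.

(** If the operators [X] compute the partial derivatives of the functions
    [ev u h * e u], then [weyl_act X] computes differential operators. *)
Lemma diffop_weyl_act X iota (P : weyl R m) (ev : 'rV[R]_m -> E -> C) (e : cfun R m) h :
  (forall u, {morph ev u : g g' / g + g'}) ->
  (forall u p g, ev u (iota p * g) = p.@[ptC u] * ev u g) ->
  (forall i g u, has_pd (fun u => ev u g * e u) i u (ev u (X i g) * e u)) ->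
  diffop P (fun u => ev u h * e u) = fun u => ev u (weyl_act X iota P h) * e u.
Proof.
move=> evD evM evX; apply/funext => w; rewrite /diffop /weyl_act.
have ev0 : ev w 0 = 0 by apply: (addrI (ev w 0)); rewrite -evD !addr0.
rewrite (big_morph (ev w) (evD w) ev0) mulr_suml; apply: eq_bigr => a _.
rewrite evM -mulrA; congr (_ * _).
suff -> : op_monom (@pderiv R m) a (fun u => ev u h * e u) =
  fun u => ev u (monom_act X a h) * e u by [].
rewrite /op_monom /monom_act; elim: (enum _) => //= i s ->.
elim: (a i) => //= k ->; apply/funext => u.
exact/has_pdE.
Qed.

Lemma diffop_lact P h z : diffop P (fun u => wval u z h * wave z u) =
  fun u => wval u z (lact P h) * wave z u.
Proof.
apply: (@diffop_weyl_act lder (@lvars C m) P (fun u => wval u z) (wave z) h) => [u g g'|u p g|i g u].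
- exact: mevalD.
- by rewrite -(wval_lvars u z) /wval mevalM.
- exact: has_pd_lder.
Qed.

Lemma diffop_ract P h w : diffop P (fun u => wval w u h * wave w u) =
  fun u => wval w u (ract P h) * wave w u.
Proof.
apply: (@diffop_weyl_act rder (@rvars C m) P (fun u => wval w u) (wave w) h) => [u g g'|u p g|i g u].
- exact: mevalD.
- by rewrite -(wval_rvars w u) /wval mevalM.
- exact: has_pd_rder.
Qed.

Lemma wval1 w z : wval w z 1 = 1. Proof. exact: meval1. Qed.

Lemma symbol_lact P w z : symbol P w z = wval w z (lact P 1).
Proof.
rewrite /symbol; have := diffop_lact P 1 z => /(congr1 (fun f => f w)).
have -> : (fun u => wval u z 1 * wave z u) = wave z by apply/funext => u; rewrite wval1 mul1r.
by move=> ->; rewrite mulfK // wave_neq0.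
Qed.

Lemma symbol_ract P w z : symbol P z w = wval w z (ract P 1).
Proof.
rewrite /symbol; have := diffop_ract P 1 w => /(congr1 (fun f => f z)).
have -> : (fun u => wval w u 1 * wave w u) = wave w by apply/funext => u; rewrite wval1 mul1r.
by move=> ->; rewrite mulfK // wave_neq0.
Qed.

(** The symbols are the polynomials P 1 and Q 1 in (w, z); two polynomials which agree
    at all real points are equal. *)
Lemma symbol_dual P Q : (forall w z, symbol P w z = symbol Q z w) ->
  lact P 1 = ract Q 1.
Proof.
move=> PQ; apply/eqP; rewrite -subr_eq0; apply/eqP.
apply: (@poly_open_eq0 _ _ setT) => [||v _]; [exact: openT|by exists 0|].
rewrite mevalB -[v]hsubmxK; have := PQ (lsubmx v) (rsubmx v).
by rewrite symbol_lact symbol_ract => h; apply/eqP; rewrite subr_eq0; apply/eqP; exact: h.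
Qed.

(** The restriction to w = 0, where the factor e^(i w.z) is 1. *)
Definition rpoly (h : E) : {mpoly C[m]} :=
  h \mPo [tuple (match fintype.split i with
                 | inl _ => 0
                 | inr j => 'X_j
                 end : {mpoly C[m]}) | i < m + m].

Lemma rpolyE h u : (rpoly h).@[ptC u] = wval 0 u h.
Proof.
rewrite comp_mpoly_meval; apply: meval_eq => i; rewrite tnth_mktuple /ptC !mxE.
by case: (fintype.split i) => j; rewrite ?meval0 ?mxE // mevalXU.
Qed.

(** [D 0 \o ... \o D (k - 1)]: the last operator acts first, which is the opposite
    of [source_comp]. *)
Fixpoint compose_ops (D : nat -> weyl R m) k (f : cfun R m) : cfun R m :=
  if k is k'.+1 then compose_ops D k' (diffop (D k') f) else f.

Lemma diffop_rpoly P h : diffop P (fun u => (rpoly h).@[ptC u]) =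
  fun u => (rpoly (ract P h)).@[ptC u].
Proof.
have e g : (fun u => (rpoly g).@[ptC u]) = (fun u => wval 0 u g * wave 0 u).
  by apply/funext => u; rewrite rpolyE waveC wave0 mulr1.
exact: etrans (congr1 (diffop P) (e h)) (etrans (diffop_ract P h 0) (esym (e (ract P h)))).
Qed.

Fixpoint source_comp (F : nat -> weyl R m) k (f : cfun R m) : cfun R m :=
  if k is k'.+1 then diffop (F k') (source_comp F k' f) else f.

(** The composed source operators are evaluated on the dual side: exchanging w and z
    reverses the composition, and at w = 0 the wave is the constant 1. *)
Lemma symbol_duality (D F : nat -> weyl R m) :
  (forall k w z, symbol (F k) w z = symbol (D k) z w) -> forall k z,
  source_comp F k (wave z) 0 = compose_ops D k (fun=> 1) z.
Proof.
move=> FD k z.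
have -> : source_comp F k (wave z) = fun u => wval u z (lact_iter 'i F k) * wave z u.
  elim: k => [|k ih].
    by apply/funext => u; rewrite /= wval1 mul1r.
  exact: etrans (congr1 (diffop (F k)) ih) (diffop_lact _ _ _).
have cT i h : compose_ops D i (fun u => (rpoly h).@[ptC u]) =
    fun u => (rpoly (ract_iter 'i D i h)).@[ptC u].
  by elim: i h => [//|i ih] h; exact: etrans (congr1 (compose_ops D i) (diffop_rpoly (D i) h)) (ih _).
have -> : (fun=> 1) = (fun u => (rpoly 1).@[ptC u]).
  by apply/funext => u; rewrite rpolyE wval1.
rewrite cT rpolyE wave0 mulr1; congr (wval 0 z _).
by apply: lact_iterE => j; apply: symbol_dual.
Qed.

Lemma compose_ops_poly (D : nat -> weyl R m) k :
  exists p : {mpoly C[m]}, compose_ops D k (fun=> 1) = fun u => p.@[ptC u].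
Proof.
have step (h : E) : exists h', compose_ops D k (fun u => (rpoly h).@[ptC u]) =
    fun u => (rpoly h').@[ptC u].
  elim: k h => [|k ih] h /=; first by exists h.
  have [h' e] := ih (ract (D k) h); exists h'.
  exact: etrans (congr1 _ (diffop_rpoly (D k) h)) e.
have [h hE] := step 1; exists (rpoly h); rewrite -hE; congr (compose_ops D k _).
by apply/funext => u; rewrite rpolyE wval1.
Qed.

End Duality.

(** * Families of functions D1^s D2^t times a polynomial *)

Section TwoPowers.
Variables (R : realType) (n : nat).
Local Notation C := R[i].
Local Notation m := (n + n)%N.
Local Notation fn := (cfun R m).
Variables (D1 D2 : 'rV[R]_m -> R) (d1 d2 : {mpoly C[m]}).
Hypothesis D1E : forall w, (D1 w)%:C = d1.@[ptC w].
Hypothesis D2E : forall w, (D2 w)%:C = d2.@[ptC w].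

Definition Omega : set 'rV[R]_m := [set w | 0 < D1 w /\ 0 < D2 w].
Hypothesis openOmega : open Omega.

Lemma near_Omega w (P : 'rV[R]_m -> Prop) :
  Omega w -> (forall u, Omega u -> P u) -> \near w, P w.
Proof.
move=> Ow OP; have := open_nbhs_nbhs (conj openOmega Ow).
by apply: filterS => u /OP.
Qed.

(** The powers are well behaved on [Omega] only, so functions are compared there; the
    partial derivatives respect this because [Omega] is open. *)
Definition eqOmega (f g : fn) := forall w, Omega w -> f w = g w.

Definition local_op (X : fn -> fn) := forall f g, eqOmega f g -> eqOmega (X f) (X g).

Lemma local_pderiv j : local_op (@pderiv R m j).
Proof. by move=> f g fg w Ow; apply: near_pderiv; apply: near_Omega. Qed.

Lemma local_iter X k : local_op X -> local_op (iter k X).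
Proof. by move=> lX f g fg; elim: k => //= k ih; apply: lX. Qed.

Lemma local_subst_op (p : {mpoly R[n]}) (X : 'I_n -> fn -> fn) :
  (forall i, local_op (X i)) -> local_op (subst_op p X).
Proof.
move=> lX f g fg w Ow; rewrite /subst_op; apply: eq_bigr => a _; congr (_ * _).
rewrite /op_monom.
suff h : eqOmega (foldr (fun i => iter (a i) (X i)) f (enum 'I_n))
   (foldr (fun i => iter (a i) (X i)) g (enum 'I_n)) by apply: h.
by elim: (enum _) => //= i s; apply: local_iter.
Qed.

(** The point (w, s, t): the parameters are treated as two additional variables, so
    that polynomial dependence on them is preserved by derivation in w. *)
Definition ptst (w : 'rV[R]_m) (s t : C) (i : 'I_(m + 2)) : C :=
  match fintype.split i with inl j => (w 0 j)%:C | inr k => pt2 s t k end.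

Lemma ptst_l w s t j : ptst w s t (lshift 2 j) = (w 0 j)%:C.
Proof. by rewrite /ptst (unsplitK (inl j)). Qed.

Lemma ptst_r w s t k : ptst w s t (rshift m k) = pt2 s t k.
Proof. by rewrite /ptst (unsplitK (inr k)). Qed.

Definition poly_family (g : C -> C -> fn) := exists N : {mpoly C[m + 2]},
  forall s t w, g s t w = N.@[ptst w s t].

Lemma poly_familyD f g : poly_family f -> poly_family g ->
  poly_family (fun s t w => f s t w + g s t w).
Proof. by move=> [M fM] [N gN]; exists (M + N) => s t w; rewrite fM gN mevalD. Qed.

Lemma poly_familyM f g : poly_family f -> poly_family g ->
  poly_family (fun s t w => f s t w * g s t w).
Proof. by move=> [M fM] [N gN]; exists (M * N) => s t w; rewrite fM gN mevalM. Qed.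

Lemma poly_family_poly (p : {mpoly C[m]}) : poly_family (fun s t w => p.@[ptC w]).
Proof.
exists (p \mPo [tuple 'X_(lshift 2 i) | i < m]) => s t w.
rewrite comp_mpoly_meval; apply: meval_eq => i.
by rewrite tnth_mktuple mevalXU ptst_l.
Qed.

Lemma poly_family_cst (c : C) : poly_family (fun s t w => c).
Proof. by exists c%:MP => s t w; rewrite mevalC. Qed.

Lemma poly_family_s : poly_family (fun s t w => s).
Proof. by exists 'X_(rshift m ord0) => s t w; rewrite mevalXU ptst_r. Qed.

Lemma poly_family_t : poly_family (fun s t w => t).
Proof. by exists 'X_(rshift m ord_max) => s t w; rewrite mevalXU ptst_r. Qed.

Lemma poly_family_pd g j : poly_family g -> exists2 g', poly_family g' &
  forall s t w, has_pd (g s t) j w (g' s t w).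
Proof.
move=> [N gN]; exists (fun s t w => N^`M(lshift 2 j).@[ptst w s t]).
  by exists N^`M(lshift 2 j).
move=> s t w; suff h : has_pd (fun u => N.@[ptst u s t]) j w N^`M(lshift 2 j).@[ptst w s t].
  by apply: near_has_pd h; near=> u; rewrite gN.
apply: has_pd_meval => k; case: (split_ordP k) => i ->.
  rewrite (inj_eq (@lshift_inj _ _)); apply: near_has_pd (has_pd_coord i j w).
  by near=> u; rewrite ptst_l.
rewrite eq_rlshift; apply: near_has_pd (has_pd_cst (pt2 s t i) j w).
by near=> u; rewrite ptst_r.
Unshelve. all: by end_near.
Qed.

Definition powers (s t : C) : fn := fun w => cpow (D1 w) s * cpow (D2 w) t.

(** The families D1^(s - L) D2^(t - L) g(s, t, w) with g polynomial are closed under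
    partial derivatives, which raise [L] by one. *)
Definition power_type_at L (g : C -> C -> fn) (f : C -> C -> fn) :=
  forall s t w, Omega w ->
    f s t w = powers (s - L%:R) (t - L%:R) w * g s t w.

Definition power_type (f : C -> C -> fn) := exists L g, poly_family g /\ power_type_at L g f.

Lemma D1_neq0 w : Omega w -> (D1 w)%:C != 0.
Proof. by move=> [w1 w2]; rewrite -[0]/(0%:C) (inj_eq (@complexI _)) gt_eqF. Qed.

Lemma D2_neq0 w : Omega w -> (D2 w)%:C != 0.
Proof. by move=> [w1 w2]; rewrite -[0]/(0%:C) (inj_eq (@complexI _)) gt_eqF. Qed.

Lemma powersB1 s t w : Omega w ->
  powers s t w = powers (s - 1) (t - 1) w * ((D1 w)%:C * (D2 w)%:C).
Proof.
move=> Ow; have [w1 w2] := Ow; rewrite /powers !cpowB1 //.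
by field; rewrite D1_neq0 ?D2_neq0.
Qed.

Lemma poly_family_D12 : poly_family (fun s t w => (D1 w)%:C * (D2 w)%:C).
Proof.
have [N NE] := poly_familyM (poly_family_poly d1) (poly_family_poly d2).
by exists N => s t w; rewrite -NE D1E D2E.
Qed.

Lemma power_type_ext f g : (forall s t, eqOmega (f s t) (g s t)) -> power_type f -> power_type g.
Proof.
by move=> fg [L [h [hp fh]]]; exists L, h; split=> // s t w Ow; rewrite -fg ?fh.
Qed.

Lemma power_type_raise f L g L' : (L <= L')%N -> poly_family g -> power_type_at L g f ->
  exists2 g', poly_family g' & power_type_at L' g' f.
Proof.
move=> /subnKC <- gp fg; elim: (L' - L)%N => [|k [g' g'p fg']].
  by exists g; rewrite ?addn0.
exists (fun s t w => (D1 w)%:C * (D2 w)%:C * g' s t w).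
  exact: poly_familyM poly_family_D12 g'p.
move=> s t w Ow; have e (x : C) : x - (L + k.+1)%:R = x - (L + k)%:R - 1.
  by rewrite addnS -natr1 opprD addrA.
by rewrite fg' // powersB1 // !e -!mulrA.
Qed.

Lemma power_typeD f g : power_type f -> power_type g -> power_type (fun s t w => f s t w + g s t w).
Proof.
move=> [L [f' [fp ff']]] [L' [g' [gp gg']]].
have [M Mp fM] := power_type_raise (leq_maxl L L') fp ff'.
have [N Np gN] := power_type_raise (leq_maxr L L') gp gg'.
exists (maxn L L'), (fun s t w => M s t w + N s t w).
split=> [|s t w Ow]; first exact: poly_familyD.
by rewrite fM // gN // mulrDr.
Qed.

Lemma power_typeM f g : poly_family g -> power_type f -> power_type (fun s t w => g s t w * f s t w).
Proof.
move=> gp [L [f' [fp ff']]]; exists L, (fun s t w => g s t w * f' s t w).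
split=> [|s t w Ow]; first exact: poly_familyM.
by rewrite ff' // mulrCA.
Qed.

Lemma power_typeZ f (c : C) : power_type f -> power_type (fun s t w => c * f s t w).
Proof. exact: (@power_typeM f (fun _ _ _ => c) (poly_family_cst c)). Qed.

Lemma power_type0 : power_type (fun s t w => 0).
Proof.
exists 0, (fun s t w => 0); split=> [|s t w _]; last by rewrite mulr0.
exact: poly_family_cst.
Qed.

Lemma power_type_powers : power_type powers.
Proof.
exists 0, (fun s t w => 1); split=> [|s t w _]; last by rewrite !subr0 mulr1.
exact: poly_family_cst.
Qed.

(** The complex polynomial [d] is real on real points, hence so are its partial
    derivatives. *)
Lemma is_derive_real (D : 'rV[R]_m -> R) (d : {mpoly C[m]}) j w :
  (forall w, (D w)%:C = d.@[ptC w]) ->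
  exists2 e : R, d^`M(j).@[ptC w] = e%:C & is_derive w (delta_mx 0 j) D e.
Proof.
move=> DE; have h := has_pd_poly d j w.
have h' : has_pd (fun u => (D u)%:C) j w d^`M(j).@[ptC w].
  by apply: near_has_pd h; near=> u; rewrite DE.
have h2 : is_derive w (delta_mx 0 j) D (complex.Re d^`M(j).@[ptC w]) := proj1 h'.
exists (complex.Re d^`M(j).@[ptC w]) => //.
by apply: (has_pd_uniq h'); apply/has_pd_real.
Unshelve. all: by end_near.
Qed.

Lemma power_type_pderiv f j : power_type f ->
  power_type (fun s t => pderiv j (f s t)) /\
  forall s t w, Omega w -> has_pd (f s t) j w (pderiv j (f s t) w).
Proof.
move=> [L [g [gp fg]]]; have [g' g'p gg'] := poly_family_pd j gp.
pose G s t w :=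
  (s - L%:R) * (d1^`M(j).@[ptC w] * d2.@[ptC w]) * g s t w +
  (t - L%:R) * (d1.@[ptC w] * d2^`M(j).@[ptC w]) * g s t w +
  (d1.@[ptC w] * d2.@[ptC w]) * g' s t w.
have Gp : poly_family G.
  have pB h : poly_family h -> poly_family (fun s t w => h s t w - L%:R).
    by move=> hp; apply: poly_familyD hp (poly_family_cst (- L%:R)).
  have pP := poly_family_poly.
  apply: poly_familyD; first apply: poly_familyD; apply: poly_familyM => //.
  - by apply: poly_familyM; [apply: (pB (fun s t w => s)); apply: poly_family_s|apply: poly_familyM; apply: pP].
  - by apply: poly_familyM; [apply: (pB (fun s t w => t)); apply: poly_family_t|apply: poly_familyM; apply: pP].
  - by apply: poly_familyM; apply: pP.
have pdf s t w : Omega w -> has_pd (f s t) j w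
    (powers (s - L.+1%:R) (t - L.+1%:R) w * G s t w).
  move=> Ow; have [w1 w2] := Ow.
  have [e1 e1E de1] := is_derive_real j w D1E.
  have [e2 e2E de2] := is_derive_real j w D2E.
  have := has_pdM (has_pdM (has_pd_cpow (s - L%:R) w1 de1)
                           (has_pd_cpow (t - L%:R) w2 de2)) (gg' s t w).
  have e (x : C) : x - L.+1%:R = x - L%:R - 1 by rewrite -natr1 opprD addrA.
  have -> : powers (s - L.+1%:R) (t - L.+1%:R) w * G s t w =
   ((s - L%:R) * (e1 / D1 w)%:C * cpow (D1 w) (s - L%:R) * cpow (D2 w) (t - L%:R) +
   cpow (D1 w) (s - L%:R) *
   ((t - L%:R) * (e2 / D2 w)%:C * cpow (D2 w) (t - L%:R))) * g s t w +
   cpow (D1 w) (s - L%:R) * cpow (D2 w) (t - L%:R) * g' s t w.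
    rewrite /powers !e !cpowB1 // /G e1E e2E -D1E -D2E.
    have h1 := D1_neq0 Ow; have h2 := D2_neq0 Ow.
    rewrite !fmorph_div /=.
    by field; rewrite h1 h2.
  by apply: near_has_pd; apply: near_Omega => // u Ou; rewrite fg.
split=> [|s t w Ow]; last by rewrite (has_pdE (pdf s t w Ow)); apply: pdf.
by exists L.+1, G; split=> // s t w Ow; apply/has_pdE/pdf.
Qed.

Lemma op_monom_fam l (X : 'I_l -> fn -> fn) (Q : (C -> C -> fn) -> Prop) a f :
  (forall i g, Q g -> Q (fun s t => X i (g s t))) ->
  Q f -> Q (fun s t => op_monom X a (f s t)).
Proof.
move=> QX Qf; rewrite /op_monom; elim: (enum _) => //= i e ih.
by elim: (a i) => //= k; apply: QX.
Qed.

Lemma power_type_diff_deriv f i : power_type f -> power_type (fun s t => @diff_deriv R n i (f s t)).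
Proof.
move=> fg; have [g1 _] := power_type_pderiv (lshift n i) fg.
have [g2 _] := power_type_pderiv (rshift n i) fg.
apply: power_type_ext (power_typeD g1 (power_typeZ (-1) g2)) => s t w _.
by rewrite /diff_deriv mulN1r.
Qed.

Definition scaled_deriv (c : C) (i : 'I_n) (f : fn) : fn :=
  fun w => c * diff_deriv i f w.

Lemma power_type_subst_op (p : {mpoly R[n]}) (X : 'I_n -> fn -> fn) f :
  (forall i g, power_type g -> power_type (fun s t => X i (g s t))) ->
  power_type f -> power_type (fun s t => subst_op p X (f s t)).
Proof.
move=> gX gf; rewrite /subst_op; elim: (msupp _) => [|a e ih].
  by apply: power_type_ext power_type0 => s t w _; rewrite big_nil.
apply: power_type_ext (power_typeD (power_typeZ (p@_a)%:C (op_monom_fam a gX gf)) ih) => s t w _.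
by rewrite big_cons.
Qed.

Lemma power_type_scaled_deriv c f i : power_type f -> power_type (fun s t => scaled_deriv c i (f s t)).
Proof. by move=> /(power_type_diff_deriv i) /(power_typeZ c). Qed.

Lemma local_diff_deriv i : local_op (@diff_deriv R n i).
Proof. by move=> f g fg w Ow; rewrite /diff_deriv !(local_pderiv _ fg). Qed.

Lemma local_scaled_deriv c i : local_op (scaled_deriv c i).
Proof. by move=> f g fg w Ow; rewrite /scaled_deriv (local_diff_deriv _ fg). Qed.

(** Constants are pulled out of a partial derivative only where the function is
    differentiable; membership in [power_type] ensures this at every stage of a
    composition of derivatives. *)
Definition proportional (k : C) (f g : C -> C -> fn) :=
  power_type g /\ forall s t, eqOmega (f s t) (fun w => k * g s t w).

Lemma proportional_scaled_deriv c k f g i : proportional k f g ->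
  proportional (c * k) (fun s t => scaled_deriv c i (f s t)) (fun s t => diff_deriv i (g s t)).
Proof.
move=> [gg fg]; split; first exact: power_type_diff_deriv.
move=> s t w Ow; rewrite (local_scaled_deriv c i (fg s t) Ow) /scaled_deriv /diff_deriv.
have h j : pderiv j (fun u => k * g s t u) w = k * pderiv j (g s t) w.
  by apply/has_pdE/has_pdZ; have [_] := power_type_pderiv j gg; apply.
by rewrite !h -mulrBr mulrA.
Qed.

Lemma proportional_iter c k f g (X Y : fn -> fn) :
  (forall k f g, proportional k f g ->
     proportional (c * k) (fun s t => X (f s t)) (fun s t => Y (g s t))) ->
  proportional k f g -> forall l,
  proportional (c ^+ l * k) (fun s t => iter l X (f s t)) (fun s t => iter l Y (g s t)).
Proof.
move=> XY fg; elim=> [|l ih] /=; first by rewrite expr0 mul1r.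
by rewrite exprS -mulrA; apply: XY.
Qed.

Lemma proportional_op_monom c k f g a : proportional k f g ->
  proportional (c ^+ mdeg a * k) (fun s t => op_monom (scaled_deriv c) a (f s t))
    (fun s t => op_monom (@diff_deriv R n) a (g s t)).
Proof.
move=> fg; rewrite /op_monom mdegE -big_enum /=.
elim: (enum _) => [|i e ih] /=; first by rewrite big_nil expr0 mul1r.
rewrite big_cons exprD -mulrA; apply: proportional_iter ih _ => k' f' g'.
exact: proportional_scaled_deriv.
Qed.

Lemma proportional_subst_op c k f g r (p : {mpoly R[n]}) :
  (forall a, a \in msupp p -> mdeg a = r) -> proportional k f g ->
  proportional (c ^+ r * k) (fun s t => subst_op p (scaled_deriv c) (f s t))
    (fun s t => subst_op p (@diff_deriv R n) (g s t)).
Proof.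
move=> pr fg; split; first by apply: power_type_subst_op fg.1 => i h; apply: power_type_diff_deriv.
move=> s t w Ow; rewrite /subst_op mulr_sumr big_seq [RHS]big_seq.
apply: eq_bigr => a ap; have [_ h] := proportional_op_monom c a fg.
by rewrite (h s t w Ow) (pr _ ap) mulrCA.
Qed.

Definition poly2 (g : C -> C -> C) := exists q : {mpoly C[2]},
  forall s t, g s t = q.@[pt2 s t].

Lemma poly2D f g : poly2 f -> poly2 g -> poly2 (fun s t => f s t + g s t).
Proof. by move=> [M fM] [N gN]; exists (M + N) => s t; rewrite fM gN mevalD. Qed.

Lemma poly2M f g : poly2 f -> poly2 g -> poly2 (fun s t => f s t * g s t).
Proof. by move=> [M fM] [N gN]; exists (M * N) => s t; rewrite fM gN mevalM. Qed.

Lemma poly2_cst (c : C) : poly2 (fun s t => c).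
Proof. by exists c%:MP => s t; rewrite mevalC. Qed.

(** Zariski density of generic sets. *)
Lemma poly2_eq f g (G : C -> C -> Prop) : poly2 f -> poly2 g -> generic_set G ->
  (forall s t, G s t -> f s t = g s t) -> forall s t, f s t = g s t.
Proof.
move=> [p fp] [q gq] gG fg s t; apply/eqP; rewrite -subr_eq0 fp gq -mevalB.
rewrite (gG (p - q)) ?meval0 // => a b /fg e.
by rewrite mevalB -fp -gq e subrr.
Qed.

Lemma poly2_family g w : poly_family g -> poly2 (fun s t => g s t w).
Proof.
move=> [N gN].
exists (N \mPo [tuple (match fintype.split i with
                       | inl j => ((w 0 j)%:C)%:MP
                       | inr k => 'X_k
                       end) | i < m + 2]) => s t.
rewrite gN comp_mpoly_meval; apply: meval_eq => i; rewrite tnth_mktuple /ptst.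
by case: (fintype.split i) => k; rewrite ?mevalC // mevalXU.
Qed.

(** The support of [D s t] may be smaller than that of the family [P] for special
    values of the parameters; the missing terms have zero coefficient. *)
Lemma poly2_diffop D (f : fn) w : polynomial_family D ->
  poly2 (fun s t => diffop (D s t) f w).
Proof.
move=> [P DP].
have -> : (fun s t => diffop (D s t) f w) =
   (fun s t => \sum_(a <- msupp P)
     (map_mpoly (meval (pt2 s t)) P@_a).@[ptC w] * op_monom (@pderiv R m) a f w).
  apply/funext => s; apply/funext => t; rewrite /diffop DP.
  set Q := map_mpoly _ P.
  have Qa a : Q@_a = map_mpoly (meval (pt2 s t)) P@_a by rewrite mcoeff_map_mpoly.
  rewrite [RHS](bigID (fun a => a \in msupp Q)) /= [X in _ + X]big1 ?addr0.
    rewrite -[RHS]big_filter (perm_big [seq a <- msupp P | a \in msupp Q]) /=.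
      by apply: eq_bigr => a _; rewrite Qa.
    apply: uniq_perm; rewrite ?filter_uniq ?msupp_uniq // => a.
    rewrite mem_filter andbC; case aQ: (a \in msupp Q); rewrite ?andbF //=.
    rewrite andbT; apply/esym; move: aQ; rewrite !mcoeff_msupp Qa.
    by apply: contraTneq => ->; rewrite raddf0 eqxx.
  by move=> a; rewrite -Qa => /memN_msupp_eq0 ->; rewrite meval0 mul0r.
elim: (msupp P) => [|a e ih].
  have -> : (fun s t : C => \sum_(a <- [::]) (map_mpoly (meval (pt2 s t)) P@_a).@[ptC w] *
     op_monom (@pderiv R m) a f w) = (fun s t => 0).
    by apply/funext => s; apply/funext => t; rewrite big_nil.
  exact: poly2_cst.
suff h : poly2 (fun s t => (map_mpoly (meval (pt2 s t)) P@_a).@[ptC w]).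
  have [q hq] := poly2D (poly2M h (poly2_cst (op_monom (@pderiv R m) a f w))) ih.
  by exists q => s t; rewrite big_cons hq.
elim/mpoly_closure: (P@_a) => [c|i|p q hp hq|p q hp hq].
- by exists c => s t; rewrite map_mpolyC mevalC.
- by exists (ptC w i)%:MP => s t; rewrite map_mpolyX mevalXU mevalC.
- have [q' hq'] := poly2D hp hq.
  by exists q' => s t; rewrite raddfD mevalD hq'.
have [q' hq'] := poly2M hp hq.
by exists q' => s t; rewrite rmorphM mevalM hq'.
Qed.

Lemma powersD s t s' t' w :
  powers (s + s') (t + t') w = powers s t w * powers s' t' w.
Proof. by rewrite /powers !cpowD mulrACA. Qed.

Lemma powers_neq0 s t w : powers s t w != 0.
Proof. by rewrite mulf_neq0 // cpow_neq0. Qed.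

Section Intertwining.
Variables (p : {mpoly R[n]}) (c : C) (D : C -> C -> weyl R m).
Local Notation A := (subst_op p (scaled_deriv c)).
Hypothesis Dpoly : polynomial_family D.

(** At a fixed point of [Omega] and for a fixed polynomial function, both sides divided
    by D1^s D2^t are polynomials in (s, t), so an identity which holds for generic
    parameters holds for all of them. *)
Lemma intertwining_extend (G : C -> C -> Prop) : generic_set G ->
  (forall s t, G s t -> forall phi : fn, smooth phi ->
     eqOmega (A (fun w => powers s t w * phi w))
             (fun w => powers (s - 1) (t - 1) w * diffop (D s t) phi w)) ->
  forall s t (q : {mpoly C[m]}),
     eqOmega (A (fun w => powers s t w * q.@[ptC w]))
       (fun w => powers (s - 1) (t - 1) w * diffop (D s t) (fun u => q.@[ptC u]) w).
Proof.
move=> gG GA s t q w Ow.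
pose f s t := A (fun w => powers s t w * q.@[ptC w]).
have [L [g [gp fg]]] : power_type f.
  apply: power_type_subst_op => [i h|]; first exact: power_type_scaled_deriv.
  apply: power_type_ext (power_typeM (poly_family_poly q) power_type_powers) => s' t' u _.
  by rewrite mulrC.
rewrite -/(f s t) fg // !powersD -2!(mulrA (powers s t w)); congr (_ * _).
move: s t; apply: (@poly2_eq (fun s t => powers (- L%:R) (- L%:R) w * g s t w)
  (fun s t => powers (- 1) (- 1) w * diffop (D s t) (fun u => q.@[ptC u]) w) G)
  => [|||s t Gst] //.
- exact: poly2M (poly2_cst _) (poly2_family _ gp).
- exact: poly2M (poly2_cst _) (poly2_diffop _ _ Dpoly).
apply: (mulfI (powers_neq0 s t w)); rewrite 2!(mulrA (powers s t w) (powers _ _ w)) -!powersD -fg //.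
by apply: GA => //; apply: smooth_poly.
Qed.

(** A^k D1^(s+k) D2^(t+k) = A^(k-1) D1^(s+k-1) D2^(t+k-1) D_(s+k,t+k) = ... =
    D1^s D2^t D_(s+1,t+1) ... D_(s+k,t+k), applied to the function 1. *)
Lemma intertwining_iter :
  (forall s t (q : {mpoly C[m]}),
     eqOmega (A (fun w => powers s t w * q.@[ptC w]))
       (fun w => powers (s - 1) (t - 1) w * diffop (D s t) (fun u => q.@[ptC u]) w)) ->
  forall s t k,
  eqOmega (iter k A (powers (s + k%:R) (t + k%:R)))
    (fun w => powers s t w *
      compose_ops (fun j => D (s + j%:R + 1) (t + j%:R + 1)) k (fun=> 1) w).
Proof.
move=> AD s t k; pose Dj (j : nat) := D (s + j%:R + 1) (t + j%:R + 1).
rewrite -/Dj.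
suff h (h : {mpoly C[m + m]}) : eqOmega
    (iter k A (fun w => powers (s + k%:R) (t + k%:R) w * (rpoly h).@[ptC w]))
    (fun w => powers s t w * compose_ops Dj k (fun u => (rpoly h).@[ptC u]) w).
  have := h 1.
  have -> : (fun u : 'rV[R]_m => (rpoly (1 : {mpoly C[m + m]})).@[ptC u]) = (fun=> 1 : C).
    by apply/funext => u; rewrite rpolyE wval1.
  have -> // : (fun w => powers (s + k%:R) (t + k%:R) w *
      (rpoly (1 : {mpoly C[m + m]})).@[ptC w]) =
     powers (s + k%:R) (t + k%:R).
  by apply: funext => u; rewrite rpolyE wval1 mulr1.
elim: k h => [|k ih] h w Ow; first by rewrite /= !addr0.
rewrite iterSr.
have e : eqOmega (A (fun w => powers (s + k.+1%:R) (t + k.+1%:R) w * (rpoly h).@[ptC w]))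
  (fun w => powers (s + k%:R) (t + k%:R) w * (rpoly (ract 'i (Dj k) h)).@[ptC w]).
  have ek (x : C) : x + k.+1%:R = x + k%:R + 1 by rewrite -natr1 addrA.
  move=> u Ou; rewrite !ek AD // !addrK; congr (_ * _).
  exact: (congr1 (fun f => f u) (diffop_rpoly (Dj k) h)).
have lA : local_op A by apply: local_subst_op => i; apply: local_scaled_deriv.
apply: etrans (local_iter k lA e Ow) (etrans (ih _ w Ow) _).
exact: (congr1 (fun f => powers s t w * compose_ops Dj k f w)
  (esym (diffop_rpoly (Dj k) h))).
Qed.

End Intertwining.

(** A homogeneous polynomial of degree [r] in [c] times the derivatives contributes
    the factor [c ^+ r]. *)
Lemma proportional_det c r k (p : {mpoly R[n]}) s t :
  (forall a, a \in msupp p -> mdeg a = r) ->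
  eqOmega (iter k (subst_op p (scaled_deriv c)) (powers s t))
    (fun w => c ^+ (r * k) * iter k (subst_op p (@diff_deriv R n)) (powers s t) w).
Proof.
move=> pr w Ow.
have h1 : proportional 1 powers powers.
  by split; [exact: power_type_powers|move=> s' t' u _; rewrite mul1r].
have := proportional_iter (fun k f g => proportional_subst_op c pr) h1 k => -[_ /(_ s t w Ow)].
by rewrite mulr1 exprM.
Qed.

End TwoPowers.

(** * Polarization, and functions that are polynomial along lines *)

Section PolarizeJordan.
Variables (R : realType) (V : zmodType) (T : V -> V -> V -> R).
Hypothesis TDl : forall x x' y z, T (x + x') y z = T x y z + T x' y z.
Hypothesis TDr : forall x y z z', T x y (z + z') = T x y z + T x y z'.
Hypothesis TC : forall x y z, T x y z = T y x z.
Hypothesis Tvvv : forall v, T v v v = 0.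

(** Comparing the values at u + v and at v - u isolates the part which is quadratic in
    u and linear in v; that part is then polarized in u = x + y. *)
Lemma polarize_cubic x y z : T x y z + T y z x + T z x y = 0.
Proof.
have TDm u v v' w : T u (v + v') w = T u v w + T u v' w.
  by rewrite TC TDl !(TC u).
have T0r u v : T u v 0 = 0 by apply: (addrI (T u v 0)); rewrite -TDr !addr0.
have TNr u v w : T u v (- w) = - T u v w.
  by apply/eqP; rewrite -subr_eq0 opprK -TDr addNr T0r.
have T0l u v : T 0 u v = 0 by apply: (addrI (T 0 u v)); rewrite -TDl !addr0.
have TNl u v w : T (- u) v w = - T u v w.
  by apply/eqP; rewrite -subr_eq0 opprK -TDl addNr T0l.
have TNm u v w : T u (- v) w = - T u v w by rewrite TC TNl TC.
have quad u v : T u u v + (T u v u + T u v u) = 0.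
  have := Tvvv (u + v); have := Tvvv (- u + v); have := Tvvv u; have := Tvvv v.
  by rewrite !(TDl, TDm, TDr, TNl, TNr, TNm) !(TC v u) ?opprK; lra.
have := quad x z; have := quad y z; have := quad (x + y) z; rewrite !(TDl, TDm, TDr) (TC y x).
by rewrite (TC z x); lra.
Qed.
End PolarizeJordan.

Section LinePolynomials.
Variables (R : realType).

Lemma poly_fun_inj (p q : {poly R}) : (forall t, p.[t] = q.[t]) -> p = q.
Proof.
move=> pq; apply/eqP; rewrite -subr_eq0; apply/negPn/negP => nz.
have := @max_poly_roots _ _ [seq k%:R | k <- iota 0 (size (p - q))] nz.
rewrite size_map size_iota ltnn => h; suff : false by []; apply: h.
  by apply/allP => _ /mapP [k _ ->]; rewrite rootE hornerD hornerN pq subrr.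
by rewrite map_inj_uniq ?iota_uniq // => i j /eqP; rewrite eqr_nat => /eqP.
Qed.

Definition dpoly (f : R -> R) (b : R) :=
  exists2 q : {poly R}, (forall t, f t = q.[t]) & (q^`()).[0] = b.

Lemma dpoly_eq f g b : dpoly f b -> (forall t, f t = g t) -> dpoly g b.
Proof. by move=> [q fq bq] fg; exists q => // t; rewrite -fg. Qed.

Lemma dpoly_uniq f b b' : dpoly f b -> dpoly f b' -> b = b'.
Proof.
move=> [q fq <-] [q' fq' <-]; congr (_^`()).[0].
by apply: poly_fun_inj => t; rewrite -fq -fq'.
Qed.

Lemma dpoly_cst (c : R) : dpoly (fun=> c) 0.
Proof. by exists c%:P => [t|]; rewrite ?derivC hornerC. Qed.

Lemma dpoly_affine (c d : R) : dpoly (fun t => c + t * d) d.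
Proof.
exists (c%:P + 'X * d%:P) => [t|]; first by rewrite !hornerE.
by rewrite derivD derivM derivX !derivC !hornerE.
Qed.

Lemma dpolyD f g b c : dpoly f b -> dpoly g c -> dpoly (fun t => f t + g t) (b + c).
Proof.
move=> [p fp <-] [q gq <-]; exists (p + q) => [t|]; first by rewrite hornerD fp gq.
by rewrite derivD hornerD.
Qed.

Lemma dpolyM f g b c : dpoly f b -> dpoly g c ->
  dpoly (fun t => f t * g t) (b * g 0 + f 0 * c).
Proof.
move=> [p fp <-] [q gq <-]; exists (p * q) => [t|]; first by rewrite hornerM fp gq.
by rewrite derivM !hornerE fp gq.
Qed.

Lemma dpoly_sum (I : Type) (s : seq I) (f : I -> R -> R) (b : I -> R) :
  (forall i, dpoly (f i) (b i)) ->
  dpoly (fun t => \sum_(i <- s) f i t) (\sum_(i <- s) b i).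
Proof.
move=> h; elim: s => [|i s ih].
  by rewrite big_nil; apply: dpoly_eq (dpoly_cst 0) _ => t; rewrite big_nil.
by rewrite big_cons; apply: dpoly_eq (dpolyD (h i) ih) _ => t; rewrite big_cons.
Qed.

Variable n : nat.
Implicit Types (x d : 'rV[R]_n) (f g : 'rV[R]_n -> R).

(** This weak form of being polynomial is enough for density arguments, which take
    place on one line at a time, and is easy to establish for the coordinates of
    vector valued functions. *)
Definition linepoly f := forall x d, exists b, dpoly (fun t => f (x + t *: d)) b.

Lemma linepoly_eq f g : linepoly f -> f =1 g -> linepoly g.
Proof. by move=> lf fg x d; have [b h] := lf x d; exists b; apply: dpoly_eq h _ => t. Qed.

Lemma linepoly_cst c : linepoly (fun=> c).
Proof. by move=> x d; exists 0; apply: dpoly_cst. Qed.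

Lemma linepoly_coord i : linepoly (fun x => x 0 i).
Proof.
move=> x d; exists (d 0 i); apply: dpoly_eq (dpoly_affine (x 0 i) (d 0 i)) _ => t.
by rewrite !mxE.
Qed.

Lemma linepolyD f g : linepoly f -> linepoly g -> linepoly (fun x => f x + g x).
Proof.
by move=> lf lg x d; have [b hb] := lf x d; have [c hc] := lg x d; exists (b + c);
  apply: dpolyD.
Qed.

Lemma linepolyM f g : linepoly f -> linepoly g -> linepoly (fun x => f x * g x).
Proof.
move=> lf lg x d; have [b hb] := lf x d; have [c hc] := lg x d.
by eexists; apply: dpolyM hb hc.
Qed.

Lemma linepoly_sum (I : Type) (s : seq I) (f : I -> 'rV[R]_n -> R) :
  (forall i, linepoly (f i)) -> linepoly (fun x => \sum_(i <- s) f i x).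
Proof.
move=> h; elim: s => [|i s ih].
  by apply: linepoly_eq (linepoly_cst 0) _ => x; rewrite big_nil.
by apply: linepoly_eq (linepolyD (h i) ih) _ => x; rewrite big_cons.
Qed.

Lemma linepoly_prod (I : Type) (s : seq I) (f : I -> 'rV[R]_n -> R) :
  (forall i, linepoly (f i)) -> linepoly (fun x => \prod_(i <- s) f i x).
Proof.
move=> h; elim: s => [|i s ih].
  by apply: linepoly_eq (linepoly_cst 1) _ => x; rewrite big_nil.
by apply: linepoly_eq (linepolyM (h i) ih) _ => x; rewrite big_cons.
Qed.

Lemma linepoly_det k (A : 'rV[R]_n -> 'M[R]_k) :
  (forall i j, linepoly (fun x => A x i j)) -> linepoly (fun x => \det (A x)).
Proof.
move=> h; apply: linepoly_sum => s; apply: linepolyM; first exact: linepoly_cst.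
by apply: linepoly_prod => i.
Qed.

Lemma linepoly_eval (p : {mpoly R[n]}) : linepoly (eval_at p).
Proof.
rewrite /eval_at; elim/mpoly_closure: p => [c|i|p q hp hq|p q hp hq].
- by apply: linepoly_eq (linepoly_cst c) _ => x; rewrite mevalC.
- by apply: linepoly_eq (linepoly_coord i) _ => x; rewrite mevalXU.
- by apply: linepoly_eq (linepolyD hp hq) _ => x; rewrite mevalD.
- by apply: linepoly_eq (linepolyM hp hq) _ => x; rewrite mevalM.
Qed.

Lemma linepoly_line f x d : linepoly f ->
  exists q : {poly R}, forall t, f (x + t *: d) = q.[t].
Proof. by move=> lf; have [_ [q h _]] := lf x d; exists q. Qed.

Lemma mpoly_fun_eq0 (p : {mpoly R[n]}) : (forall x, eval_at p x = 0) -> p = 0.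
Proof.
move=> p0; pose pc := map_mpoly (real_complex R) p.
have : pc = 0.
  apply: (@poly_open_eq0 _ _ setT) => [||w _]; [exact: openT|by exists 0|].
  rewrite -[0]/((0 : R)%:C) -(p0 w) /pc /eval_at /ptC.
  elim/mpoly_closure: (p) => [c|i|f g hf hg|f g hf hg].
  - by rewrite map_mpolyC !mevalC.
  - by rewrite map_mpolyX !mevalXU.
  - rewrite (raddfD (map_mpoly _)) /=.
    move: (map_mpoly _ f) (map_mpoly _ g) hf hg => F G hF hG.
    by rewrite !mevalD rmorphD hF hG.
  - rewrite (rmorphM (map_mpoly _)) /=.
    move: (map_mpoly _ f) (map_mpoly _ g) hf hg => F G hF hG.
    by rewrite !mevalM rmorphM hF hG.
move=> e; apply/mpolyP => a; have := congr1 (fun q => q@_a) e.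
by rewrite /pc mcoeff_map_mpoly !mcoeff0 => -[].
Qed.

(** If p(2x) = 2^k p(x), comparing coefficients gives 2^|a| = 2^k for every monomial a
    of p. *)
Lemma homog_fun (p : {mpoly R[n]}) k :
  (forall x, eval_at p (2%:R *: x) = 2%:R ^+ k * eval_at p x) ->
  forall a, a \in msupp p -> mdeg a = k.
Proof.
move=> h a ap.
pose q := \sum_(b <- msupp p) (p@_b * (2%:R ^+ mdeg b - 2%:R ^+ k)) *: 'X_[b].
have q0 : q = 0.
  apply: mpoly_fun_eq0 => x; rewrite /eval_at raddf_sum /=.
  under eq_bigr do rewrite mevalZ mevalX mulrBr mulrBl.
  rewrite big_split /= sumrN; apply/eqP; rewrite subr_eq0; apply/eqP.
  transitivity (eval_at p (2%:R *: x)).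
    rewrite /eval_at mevalE; apply: eq_bigr => b _; rewrite -mulrA; congr (_ * _).
    rewrite mdegE expr_sum -big_split /=; apply: eq_bigr => i _.
    by rewrite mxE exprMn.
  rewrite h /eval_at mevalE mulr_sumr; apply: eq_bigr => b _.
  by rewrite mulrA [_ * p@_b]mulrC.
have := congr1 (fun q => q@_a) q0.
rewrite /q raddf_sum /= mcoeff0 (bigD1_seq a) ?msupp_uniq //= big1 ?addr0.
  rewrite mcoeffZ mcoeffX eqxx mulr1 => /eqP.
  rewrite mulf_eq0 mcoeff_eq0 ap subr_eq0 /=.
  rewrite -!natrX eqr_nat => /eqP; apply: expnI; exact: ltnSn.
by move=> b /negbTE ba; rewrite mcoeffZ mcoeffX ba mulr0.
Qed.

Lemma eval_linear (p : {mpoly R[n]}) : (forall a, a \in msupp p -> mdeg a = 1%N) ->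
  forall (c : R) x y, eval_at p (c *: x + y) = c * eval_at p x + eval_at p y.
Proof.
move=> h c x y; rewrite /eval_at !mevalE mulr_sumr -big_split /= big_seq [RHS]big_seq.
apply: eq_bigr => a /h/eqP/mdeg1P [i /eqP ->].
have e (v : 'I_n -> R) : \prod_j v j ^+ U_(i)%MM j = v i.
  by rewrite -mevalX mevalXU.
by rewrite !e !mxE; ring.
Qed.

End LinePolynomials.

(** * Jordan algebras: inner derivations and powers *)

Section JordanAlgebra.
Variables (R : realType) (n : nat) (J : jordanAlgebra R n).
Local Notation V := 'rV[R]_n.
Local Notation "x ** y" := (jmul J x y) (at level 40, left associativity).
Local Notation e := (jone J).

Lemma jmulDr x y z : x ** (y + z) = x ** y + x ** z.
Proof. by have := jmul_linear J x 1 y z; rewrite !scale1r. Qed.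

Lemma jmul0r x : x ** 0 = 0.
Proof. by apply: (addrI (x ** 0)); rewrite -jmulDr !addr0. Qed.

Lemma jmulZr x c y : x ** (c *: y) = c *: (x ** y).
Proof. by have := jmul_linear J x c y 0; rewrite jmul0r !addr0. Qed.

Lemma jmulDl x y z : (x + y) ** z = x ** z + y ** z.
Proof. by rewrite !(jmulC J _ z) jmulDr. Qed.

Lemma jmulZl c x y : (c *: x) ** y = c *: (x ** y).
Proof. by rewrite !(jmulC J _ y) jmulZr. Qed.

Lemma jmul_sumr (I : Type) (s : seq I) x (f : I -> V) :
  x ** (\sum_(i <- s) f i) = \sum_(i <- s) x ** f i.
Proof.
by elim: s => [|i s ih]; rewrite ?big_nil ?jmul0r // !big_cons jmulDr ih.
Qed.

Lemma jmul_coord x y k : (x ** y) 0 k =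
  \sum_i \sum_j x 0 i * (y 0 j * (delta_mx 0 i ** delta_mx 0 j) 0 k).
Proof.
have ex (z : V) : z = \sum_i z 0 i *: delta_mx 0 i by rewrite -row_sum_delta.
rewrite {1}(ex x) jmulC jmul_sumr summxE; apply: eq_bigr => i _.
rewrite jmulZr jmulC {1}(ex y) jmul_sumr scaler_sumr summxE; apply: eq_bigr => j _.
by rewrite jmulZr !mxE.
Qed.

(** The full polarization of the Jordan identity in [x]. *)
Lemma jordan_linearized x y z a :
  (x ** y) ** (z ** a) + (y ** z) ** (x ** a) + (z ** x) ** (y ** a) =
  z ** ((x ** y) ** a) + x ** ((y ** z) ** a) + y ** ((z ** x) ** a).
Proof.
apply/rowP => k.
have := @polarize_cubic R V
  (fun u v w => ((u ** v) ** (w ** a) - w ** ((u ** v) ** a)) 0 k) _ _ _ _ x y z.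
rewrite !mxE => h; apply/eqP; rewrite -subr_eq0; apply/eqP; rewrite -[RHS]h.
- by ring.
- by move=> u u' v w; rewrite !(jmulDl, jmulDr) !mxE; ring.
- by move=> u v w w'; rewrite !(jmulDl, jmulDr) !mxE; ring.
- by move=> u v w; rewrite (jmulC J u v).
- by move=> v; rewrite (jmul_jordan J v a) subrr mxE.
Qed.

(** The commutator of the multiplications by [x] and by [y]. *)
Definition jcomm (x y z : V) : V := x ** (y ** z) - y ** (x ** z).

(** The left-hand side of the linearized identity is invariant under the exchange of
    [x] and [a]; the difference of the two right-hand sides is the Leibniz rule. *)
Lemma jcomm_derivation x a y z :
  jcomm a x (y ** z) = jcomm a x y ** z + y ** jcomm a x z.
Proof.
have h1 := jordan_linearized x y z a; have h2 := jordan_linearized a y z x.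
have jB u v w : (u - v) ** w = u ** w - v ** w.
  by rewrite jmulDl -scaleN1r jmulZl scaleN1r.
have jBr u v w : w ** (u - v) = w ** u - w ** v by rewrite !(jmulC J w) jB.
have eqs : (x ** y) ** (z ** a) + (y ** z) ** (x ** a) + (z ** x) ** (y ** a) =
           (a ** y) ** (z ** x) + (y ** z) ** (a ** x) + (z ** a) ** (y ** x).
  have -> : (z ** a) ** (y ** x) = (x ** y) ** (z ** a) by rewrite jmulC (jmulC J y).
  have -> : (a ** y) ** (z ** x) = (z ** x) ** (y ** a) by rewrite jmulC (jmulC J a).
  by rewrite (jmulC J a x) [RHS]addrC addrA [RHS]addrAC.
have e1 : z ** ((x ** y) ** a) + x ** ((y ** z) ** a) + y ** ((z ** x) ** a) =
          z ** (a ** (x ** y)) + x ** (a ** (y ** z)) + y ** (a ** (x ** z)).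
  by rewrite (jmulC J (x ** y) a) (jmulC J (y ** z) a) (jmulC J z x) (jmulC J (x ** z) a).
have e2 : z ** ((a ** y) ** x) + a ** ((y ** z) ** x) + y ** ((z ** a) ** x) =
          z ** (x ** (a ** y)) + a ** (x ** (y ** z)) + y ** (x ** (a ** z)).
  by rewrite (jmulC J (a ** y) x) (jmulC J (y ** z) x) (jmulC J z a) (jmulC J (a ** z) x).
have h : z ** (a ** (x ** y)) + x ** (a ** (y ** z)) + y ** (a ** (x ** z)) =
         z ** (x ** (a ** y)) + a ** (x ** (y ** z)) + y ** (x ** (a ** z)).
  by rewrite -e1 -e2 -h1 -h2.
rewrite /jcomm jB jBr (jmulC J (a ** _) z) (jmulC J (x ** (a ** y)) z).
by apply/rowP => k; move/rowP/(_ k): h; rewrite !mxE; lra.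
Qed.

Lemma jpow0 x : jpow J x 0 = e. Proof. by []. Qed.
Lemma jpowS x k : jpow J x k.+1 = x ** jpow J x k. Proof. by []. Qed.

Lemma jhornerE N (p : {poly R}) x : (size p <= N)%N ->
  jhorner J p x = \sum_(i < N) p`_i *: jpow J x i.
Proof.
move=> sp; rewrite /jhorner (big_ord_widen N (fun i => p`_i *: jpow J x i)) //.
rewrite big_mkcond; apply: eq_bigr => i _; case: ltnP => // /(nth_default 0) ->.
by rewrite scale0r.
Qed.

Lemma jhornerD (p q : {poly R}) x : jhorner J (p + q) x = jhorner J p x + jhorner J q x.
Proof.
pose N := maxn (size p) (size q).
have spq : (size (p + q)%R <= N)%N by apply: size_polyD.
rewrite (jhornerE x spq) (jhornerE x (leq_maxl (size p) (size q))).
rewrite (jhornerE x (leq_maxr (size p) (size q))).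
by rewrite -big_split /=; apply: eq_bigr => i _; rewrite coefD scalerDl.
Qed.

Lemma jhornerZ c (p : {poly R}) x : jhorner J (c *: p) x = c *: jhorner J p x.
Proof.
rewrite (@jhornerE (size p) (c *: p)) ?size_scale_leq // scaler_sumr.
by apply: eq_bigr => i _; rewrite coefZ scalerA.
Qed.

Lemma jhornerMX (p : {poly R}) x : jhorner J (p * 'X) x = x ** jhorner J p x.
Proof.
rewrite (@jhornerE (size p).+1 (p * 'X)); last first.
  by have [->|p0] := eqVneq p 0; rewrite ?mul0r ?size_poly0 // size_mulX.
rewrite big_ord_recl coefMX eqxx scale0r add0r jmul_sumr.
by apply: eq_bigr => i _; rewrite coefMX /= jmulZr.
Qed.

Lemma jhornerC c x : jhorner J c%:P x = c *: e.
Proof. by rewrite (@jhornerE 1) ?size_polyC_leq1 // big_ord1 coefC. Qed.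

Lemma jhorner0 x : jhorner J 0 x = 0.
Proof. by rewrite -[0]/(0%:P) jhornerC scale0r. Qed.

Lemma jhorner_translate (p : {poly R}) x t :
  jhorner J p (x + t *: e) = jhorner J (p \Po ('X + t%:P)) x.
Proof.
elim/poly_ind: p => [|p c ih]; first by rewrite comp_poly0 !jhorner0.
rewrite comp_poly_MXaddC !jhornerD !jhornerC jhornerMX ih mulrDr jhornerD jhornerMX.
by rewrite jmulDl jmulZl jmul1 -[_ * t%:P]mulrC mul_polyC jhornerZ.
Qed.

Lemma jpow_scale t x k : jpow J (t *: x) k = t ^+ k *: jpow J x k.
Proof.
elim: k => [|k ih]; first by rewrite scale1r.
by rewrite !jpowS ih jmulZr jmulZl scalerA exprSr.
Qed.

Lemma linepoly_jpow k i : linepoly (fun x => jpow J x k 0 i).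
Proof.
elim: k i => [|k ih] i; first exact: linepoly_cst.
have h : linepoly (fun x => \sum_a \sum_b x 0 a * (jpow J x k 0 b *
    (delta_mx 0 a ** delta_mx 0 b) 0 i)).
  apply: linepoly_sum => a; apply: linepoly_sum => b.
  exact: linepolyM (linepoly_coord a) (linepolyM (ih b) (linepoly_cst _)).
by apply: linepoly_eq h _ => x; rewrite -jmul_coord.
Qed.

(** For a derivation [D], the Leibniz rule says that the derivative of x^k in the
    direction [D x] is [D (x^k)]. *)
Lemma dpoly_jpow (D : V -> V) x k i :
  (forall y z, D (y ** z) = D y ** z + y ** D z) ->
  dpoly (fun t => jpow J (x + t *: D x) k 0 i) (D (jpow J x k) 0 i).
Proof.
move=> DM; elim: k i => [|k ih] i.
  have De : D e = 0.
    by apply: (addrI (D e)); rewrite addr0 -{3}(jmul1 J e) DM jmul1 jmulC jmul1.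
  by rewrite jpow0 De mxE; apply: dpoly_cst.
rewrite jpowS DM mxE !jmul_coord -big_split.
under eq_bigr do rewrite -big_split.
suff h : dpoly (fun t => \sum_a \sum_b (x 0 a + t * D x 0 a) *
    (jpow J (x + t *: D x) k 0 b * (delta_mx 0 a ** delta_mx 0 b) 0 i))
  (\sum_a \sum_b (D x 0 a * (jpow J x k 0 b * (delta_mx 0 a ** delta_mx 0 b) 0 i) +
     x 0 a * (D (jpow J x k) 0 b * (delta_mx 0 a ** delta_mx 0 b) 0 i))).
  apply: dpoly_eq h _ => t; rewrite jmul_coord.
  by apply: eq_bigr => a _; apply: eq_bigr => b _; rewrite !mxE.
apply: dpoly_sum => a; apply: dpoly_sum => b.
have [q hq hb] := dpolyM (dpoly_affine (x 0 a) (D x 0 a))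
  (dpolyM (ih b) (dpoly_cst ((delta_mx 0 a ** delta_mx 0 b) 0 i))).
by exists q => //; rewrite hb mulr0 addr0 mul0r addr0 scale0r addr0.
Qed.

End JordanAlgebra.

(** * The generic minimal polynomial *)

Section GenericMinimalPolynomial.
Variables (R : realType) (n r : nat) (J : jordanAlgebra R n).
Local Notation V := 'rV[R]_n.
Local Notation "x ** y" := (jmul J x y) (at level 40, left associativity).
Local Notation e := (jone J).

(** The n + 1 vectors 1, x, ..., x^n are linearly dependent. *)
Lemma minpoly_exists (x : V) : exists p, is_minpoly J x p.
Proof.
pose ann (q : {poly R}) := q \is monic /\ jhorner J q x = 0.
have [q0 [q0m q0x]] : exists q, ann q.
  pose A : 'M[R]_(n.+1, n) := \matrix_(i < n.+1) jpow J x i.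
  have kA : kermx A != 0.
    rewrite -mxrank_eq0 mxrank_ker subn_eq0 -ltnNge ltnS; exact: rank_leq_col.
  have [i ui] : exists i, row i (kermx A) != 0.
    apply/existsP; apply: contraNT kA; rewrite negb_exists => /forallP h.
    by apply/eqP/row_matrixP => i; rewrite row0; apply/eqP; have := h i; rewrite negbK.
  pose u := row i (kermx A).
  pose q : {poly R} := \poly_(j < n.+1) u 0 (inord j).
  have qx : jhorner J q x = 0.
    have uA : u *m A = 0 by rewrite /u -row_mul mulmx_ker row0.
    rewrite (@jhornerE _ _ _ n.+1) ?size_poly // -[RHS]uA mulmx_sum_row.
    by apply: eq_bigr => j _; rewrite coef_poly ltn_ord inord_val rowK.
  have q0 : q != 0.
    apply: contra ui => /eqP q0; apply/eqP/rowP => j; rewrite -/u [RHS]mxE.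
    by have := congr1 (fun q : {poly R} => q`_j) q0; rewrite coef_poly ltn_ord inord_val coef0.
  exists ((lead_coef q)^-1 *: q); split; last by rewrite jhornerZ qx scaler0.
  by rewrite monicE lead_coefZ mulVf // lead_coef_eq0.
have ex : exists k, `[< exists2 q, ann q & size q = k >].
  by exists (size q0); apply/asboolP; exists q0.
case: (ex_minnP ex) => k /asboolP [p [pm px] sp] kmin.
exists p; split=> // q qm qx; rewrite sp; apply: kmin; apply/asboolP.
by exists q.
Qed.

(** That is, 1, x, ..., x^(r-1) are linearly independent. *)
Definition regular (x : V) :=
  forall q : {poly R}, (size q <= r)%N -> jhorner J q x = 0 -> q = 0.

Definition power_mx (x : V) : 'M[R]_(r, n) := \matrix_(i < r) jpow J x i.

Lemma regularP x : reflect (regular x) (row_free (power_mx x)).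
Proof.
have hx (q : {poly R}) : (size q <= r)%N ->
    jhorner J q x = (\row_(j < r) q`_j) *m power_mx x.
  move=> sq; rewrite (jhornerE J x sq) mulmx_sum_row.
  by apply: eq_bigr => j _; rewrite rowK mxE.
apply: (iffP idP) => [free q sq|reg].
  rewrite hx // => q0; apply/polyP => j; rewrite coef0.
  have [jr|rj] := ltnP j r; last by rewrite nth_default // (leq_trans sq).
  have : \row_(j < r) q`_j = 0 :> 'rV[R]_r.
    by apply: (row_free_inj free); rewrite q0 mul0mx.
  by move=> /rowP/(_ (Ordinal jr)); rewrite !mxE.
rewrite -kermx_eq0; apply/eqP/row_matrixP => i; rewrite row0; set u := row _ _.
have uM : u *m power_mx x = 0 by rewrite /u -row_mul mulmx_ker row0.
have q0 := reg (\poly_(j < r) (if insub j is Some k then u 0 k else 0)) (size_poly _ _).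
apply/rowP => j; rewrite [RHS]mxE.
have := congr1 (fun q : {poly R} => q`_j) (q0 _).
rewrite coef0 coef_poly ltn_ord valK; apply.
rewrite hx ?size_poly // -[RHS]uM; congr (_ *m _); apply/rowP => k.
by rewrite mxE coef_poly ltn_ord valK.
Qed.

Hypothesis hr : has_rank J r.

Lemma regular_exists : exists x, regular x.
Proof.
have [[x [p [[pm px pmin] sp]]] _] := hr; exists x => q sq qx.
apply/eqP/negPn/negP => q0.
have : (size p <= size ((lead_coef q)^-1 *: q))%N.
  apply: pmin; last by rewrite jhornerZ qx scaler0.
  by rewrite monicE lead_coefZ mulVf // lead_coef_eq0.
rewrite size_scale ?invr_eq0 ?lead_coef_eq0 // sp => h.
by have := leq_trans h sq; rewrite ltnn.
Qed.

(** On the line from a regular element x0 to x, regularity is implied by the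
    nonvanishing of det (M(y) B), where M(y) is the matrix of the first r powers of y
    and B is a right inverse of M(x0): this polynomial takes the value 1 at x0. *)
Lemma regular_dense (f : V -> R) : linepoly f ->
  (forall x, regular x -> f x = 0) -> forall x, f x = 0.
Proof.
move=> lf f0 x; have [x0 /regularP /row_freeP [B MB]] := regular_exists.
pose d := x - x0.
have [q fq] := linepoly_line x0 d lf.
have lg : linepoly (fun y => \det (power_mx y *m B)).
  apply: linepoly_det => i j.
  have h : linepoly (fun y => \sum_k jpow J y i 0 k * B k j).
    by apply: linepoly_sum => k; apply: linepolyM (linepoly_jpow _ _ _) (linepoly_cst _).
  by apply: linepoly_eq h _ => y; rewrite mxE; apply: eq_bigr => k _; rewrite mxE.
have [g gE] := linepoly_line x0 d lg.
have qg : q * g = 0.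
  apply: poly_fun_inj => t; rewrite hornerM horner0 -gE -fq.
  have [->|dt] := eqVneq (\det (power_mx (x0 + t *: d) *m B)) 0; first exact: mulr0.
  rewrite f0 ?mul0r //; apply/regularP.
  have u : power_mx (x0 + t *: d) *m B \in unitmx by rewrite unitmxE unitfE.
  by apply/row_freeP; exists (B *m invmx (power_mx (x0 + t *: d) *m B)); rewrite mulmxA mulmxV.
have g0 : g != 0.
  apply/eqP => g0; have := gE 0; rewrite scale0r addr0 MB det1 g0 horner0 => /eqP.
  by rewrite oner_eq0.
move/eqP: qg; rewrite mulf_eq0 (negbTE g0) orbF => /eqP q0.
by have := fq 1; rewrite scale1r addrC subrK q0 horner0.
Qed.

Lemma regular_uniq x (p q : {poly R}) : regular x -> p \is monic -> q \is monic ->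
  size p = r.+1 -> size q = r.+1 -> jhorner J p x = 0 -> jhorner J q x = 0 -> p = q.
Proof.
move=> reg pm qm sp sq px qx; apply/eqP; rewrite -subr_eq0; apply/eqP; apply: reg.
  apply/leq_sizeP => j; rewrite leq_eqVlt => /predU1P [<-|rj].
    move: pm qm; rewrite !monicE !lead_coefE sp sq coefB /= => /eqP -> /eqP ->.
    exact: subrr.
  by rewrite coefB !nth_default ?subr0 ?sp ?sq.
by rewrite jhornerD -scaleN1r jhornerZ px qx scaler0 addr0.
Qed.

Variable m : {poly {mpoly R[n]}}.
Hypothesis hm : is_generic_minpoly J r m.

(** The specialization of the generic minimal polynomial. It is a priori meaningful at
    regular elements only; its properties extend to all elements by density. *)
Definition minpoly_at (x : V) : {poly R} := map_poly (fun c => eval_at c x) m.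

Lemma minpoly_at_coef x j : (minpoly_at x)`_j = eval_at m`_j x.
Proof. by rewrite coef_map_id0 // /eval_at meval0. Qed.

Lemma minpoly_at_regular x : regular x ->
  [/\ minpoly_at x \is monic, jhorner J (minpoly_at x) x = 0 & size (minpoly_at x) = r.+1].
Proof.
move=> reg; have [p pmin] := minpoly_exists x; have [pm px _] := pmin.
have sp : size p = r.+1.
  apply/eqP; rewrite eqn_leq (proj2 hr _ _ pmin) ltnNge; apply/negP => sp.
  by have p0 := reg _ sp px; move: pm; rewrite p0 monicE lead_coef0 eq_sym oner_eq0.
by rewrite /minpoly_at (hm pmin sp).
Qed.

Lemma linepoly_coef j : linepoly (fun x => (minpoly_at x)`_j).
Proof. by apply: linepoly_eq (linepoly_eval m`_j) _ => x; rewrite minpoly_at_coef. Qed.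

Lemma minpoly_at_coefr x : (minpoly_at x)`_r = 1.
Proof.
apply/eqP; rewrite -subr_eq0; apply/eqP; move: x; apply: regular_dense => [|x reg].
  exact: linepolyD (linepoly_coef r) (linepoly_cst (-1)).
have [/monicP + _ sp] := minpoly_at_regular reg.
by rewrite lead_coefE sp /= => ->; rewrite subrr.
Qed.

Lemma minpoly_at_size x : (size (minpoly_at x) <= r.+1)%N.
Proof.
apply/leq_sizeP => j rj; move: x; apply: regular_dense => [|x reg]; first exact: linepoly_coef.
by have [_ _ sp] := minpoly_at_regular reg; rewrite nth_default // sp.
Qed.

Lemma minpoly_at_monic x : size (minpoly_at x) = r.+1 /\ minpoly_at x \is monic.
Proof.
have s : size (minpoly_at x) = r.+1.
  apply/eqP; rewrite eqn_leq minpoly_at_size ltnNge; apply/negP => h.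
  by have := minpoly_at_coefr x; rewrite nth_default // => /eqP; rewrite eq_sym oner_eq0.
by split=> //; rewrite monicE lead_coefE s minpoly_at_coefr.
Qed.

Lemma minpoly_at_annul x : \sum_(j < r.+1) (minpoly_at x)`_j *: jpow J x j = 0.
Proof.
apply/rowP => k; rewrite [RHS]mxE summxE; move: x; apply: regular_dense => [|x reg].
  apply: linepoly_sum => j.
  apply: linepoly_eq (linepolyM (linepoly_coef j) (linepoly_jpow J j k)) _ => x.
  by rewrite mxE.
have [_ + _] := minpoly_at_regular reg.
by rewrite (jhornerE J x (minpoly_at_size x)) => /rowP/(_ k); rewrite mxE summxE.
Qed.

(** For regular x the two sides are monic of degree r and annihilate x + t e. *)
Lemma minpoly_at_translate x t :
  minpoly_at (x + t *: e) = minpoly_at x \Po ('X - t%:P).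
Proof.
have sC (p : {poly R}) (c : R) : size (p \Po ('X + c%:P)) = size p.
  by rewrite -[c]opprK polyCN size_comp_poly2 ?size_XsubC.
have reg_t y c : regular y -> regular (y + c *: e).
  move=> reg q sq; rewrite jhorner_translate => /reg; rewrite sC => /(_ sq) q0.
  by apply/eqP; rewrite -size_poly_eq0 -(sC q c) q0 size_poly0.
have compK (p : {poly R}) : (p \Po ('X - t%:P)) \Po ('X + t%:P) = p.
  by rewrite -comp_polyA comp_polyB comp_polyX comp_polyC addrK comp_polyXr.
apply/polyP => j; apply/eqP; rewrite -subr_eq0; apply/eqP; move: x.
apply: regular_dense => [|x reg].
  have ls : linepoly (fun x => \sum_(i < r.+1) (minpoly_at x)`_i * (('X - t%:P) ^+ i)`_j).
    by apply: linepoly_sum => i; apply: linepolyM (linepoly_coef i) (linepoly_cst _).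
  have lt : linepoly (fun x => (minpoly_at (x + t *: e))`_j).
    move=> y d; have [b h] := linepoly_coef j (y + t *: e) d.
    by exists b; apply: dpoly_eq h _ => u; rewrite addrAC.
  apply: linepoly_eq (linepolyD lt (linepolyM (linepoly_cst (-1)) ls)) _ => x.
  rewrite mulN1r; congr (_ - _); rewrite comp_polyE (proj1 (minpoly_at_monic x)) coef_sum.
  by apply: eq_bigr => i _; rewrite coefZ.
apply/eqP; rewrite subr_eq0; apply/eqP.
suff -> : minpoly_at (x + t *: e) = minpoly_at x \Po ('X - t%:P) by [].
have [s1 m1] := minpoly_at_monic (x + t *: e); have [s2 m2] := minpoly_at_monic x.
apply: (@regular_uniq (x + t *: e)) => //; first exact: reg_t.
- by rewrite monicE lead_coef_comp ?size_XsubC // lead_coefXsubC expr1n mulr1 -monicE.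
- by rewrite -polyCN sC.
- by have [] := minpoly_at_regular (reg_t x t reg).
- by rewrite jhorner_translate compK; have [] := minpoly_at_regular reg.
Qed.

(** For regular x the right-hand sides are the coefficients of a monic polynomial of
    degree r which annihilates t x. *)
Lemma minpoly_at_scale x t j : t != 0 -> (j <= r)%N ->
  (minpoly_at (t *: x))`_j = t ^+ (r - j) * (minpoly_at x)`_j.
Proof.
move=> t0 jr.
have reg_t y : regular y -> regular (t *: y).
  move=> reg q sq qy.
  have q0 : \poly_(i < r) (q`_i * t ^+ i) = 0.
    apply: reg; first exact: size_poly.
    rewrite (jhornerE J y (size_poly _ _)) -[RHS]qy (jhornerE J _ sq).
    by apply: eq_bigr => i _; rewrite coef_poly ltn_ord jpow_scale scalerA.
  apply/polyP => i; rewrite coef0; have [ir|ri] := ltnP i r.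
    have := congr1 (fun p : {poly R} => p`_i) q0; rewrite coef_poly ir coef0 => /eqP.
    by rewrite mulf_eq0 expf_eq0 (negbTE t0) andbF orbF => /eqP.
  by rewrite nth_default // (leq_trans sq).
apply/eqP; rewrite -subr_eq0; apply/eqP; move: x; apply: regular_dense => [|x reg].
  have lt : linepoly (fun x => (minpoly_at (t *: x))`_j).
    move=> y d; have [b h] := linepoly_coef j (t *: y) (t *: d).
    by exists b; apply: dpoly_eq h _ => u; rewrite scalerDr !scalerA [u * t]mulrC.
  have ls := linepolyM (linepoly_cst (- t ^+ (r - j))) (linepoly_coef j).
  apply: linepoly_eq (linepolyD lt ls) _ => x.
  by rewrite mulNr.
apply/eqP; rewrite subr_eq0; apply/eqP.
pose q := \poly_(i < r.+1) (t ^+ (r - i) * (minpoly_at x)`_i).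
have qr : q`_r = 1 by rewrite coef_poly ltnSn subnn expr0 mul1r minpoly_at_coefr.
have sq : size q = r.+1.
  apply/eqP; rewrite eqn_leq size_poly ltnNge; apply/negP => h.
  by move: qr; rewrite nth_default // => /eqP; rewrite eq_sym oner_eq0.
have -> : minpoly_at (t *: x) = q.
  have [s1 m1] := minpoly_at_monic (t *: x).
  apply: (@regular_uniq (t *: x)) => //; first exact: reg_t.
  - by rewrite monicE lead_coefE sq qr.
  - by have [] := minpoly_at_regular (reg_t x reg).
  rewrite (jhornerE J _ (size_poly _ _)).
  transitivity (t ^+ r *: \sum_(i < r.+1) (minpoly_at x)`_i *: jpow J x i).
    rewrite scaler_sumr; apply: eq_bigr => i _.
    rewrite coef_poly ltn_ord jpow_scale !scalerA; congr (_ *: _).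
    by rewrite mulrAC -exprD subnK // -ltnS.
  by rewrite minpoly_at_annul scaler0.
by rewrite coef_poly ltnS jr.
Qed.

(** The coefficients of degree less than r are homogeneous of positive degree. *)
Lemma minpoly_at0 : minpoly_at 0 = 'X^r.
Proof.
apply/polyP => j; rewrite coefXn; case: (ltngtP j r) => [jr|rj|->].
- have := @minpoly_at_scale 0 2%:R j _ (ltnW jr); rewrite scaler0 pnatr_eq0 => /(_ isT) /eqP.
  rewrite -subr_eq0 -{1}[(minpoly_at 0)`_j]mul1r -mulrBl mulf_eq0 subr_eq0.
  case/orP => [|/eqP //]; rewrite eq_sym -natrX pnatr_eq1.
  by move=> h; have := eqn_exp2l (r - j) 0 (ltnSn 1); rewrite expn0 h subn_eq0 leqNgt jr.
- by rewrite nth_default // (leq_trans (minpoly_at_size 0)).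
- exact: minpoly_at_coefr.
Qed.

Lemma minpoly_at_one : minpoly_at e = ('X - 1) ^+ r.
Proof.
have := minpoly_at_translate 0 1; rewrite add0r scale1r minpoly_at0 => ->.
by rewrite rmorphXn /= comp_polyX polyC1.
Qed.

Lemma jdetE x : eval_at (jdet r m) x = (-1) ^+ r * (minpoly_at x)`_0.
Proof.
rewrite minpoly_at_coef /eval_at /jdet mevalM; congr (_ * _).
by rewrite rmorphXn rmorphN1.
Qed.

Lemma jtrE x : eval_at (jtr r m) x = - (minpoly_at x)`_r.-1.
Proof. by rewrite minpoly_at_coef /eval_at /jtr mevalN. Qed.

Lemma jdet_one : eval_at (jdet r m) e = 1.
Proof.
rewrite jdetE minpoly_at_one -horner_coef0 horner_exp !hornerE -exprMn.
by rewrite mulrN1 opprK expr1n.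
Qed.

Hypothesis r_gt0 : (0 < r)%N.

Lemma jtr_one : eval_at (jtr r m) e = r%:R.
Proof.
rewrite jtrE minpoly_at_one.
have -> : ('X - 1 : {poly R}) ^+ r = \prod_(x <- nseq r 1) ('X - x%:P).
  by rewrite big_nseq iter_mulr_1 polyC1.
have := @coefPn_prod_XsubC R (nseq r 1); rewrite size_nseq => ->; last by rewrite -lt0n.
by rewrite opprK big_nseq iter_addr_0.
Qed.

Lemma jdet_homog a : a \in msupp (jdet r m) -> mdeg a = r.
Proof.
apply: homog_fun => x; rewrite !jdetE minpoly_at_scale ?pnatr_eq0 //.
by rewrite subn0 mulrCA.
Qed.

Lemma jtr_linear c x y :
  eval_at (jtr r m) (c *: x + y) = c * eval_at (jtr r m) x + eval_at (jtr r m) y.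
Proof.
apply: eval_linear => a; apply: homog_fun => {}x.
rewrite !jtrE minpoly_at_scale ?pnatr_eq0 ?leq_pred //.
by rewrite -subn1 subKn // mulrN.
Qed.

(** Differentiate the identity p_x(x) = 0 at a regular x in the direction D x: the
    derivatives of the powers contribute D (p_x(x)) = 0, so the derivatives of the
    coefficients are the coefficients of a linear relation between 1, ..., x^(r-1),
    hence vanish. One of these coefficients is minus the trace, which is linear. *)
Lemma jtr_derivation (D : {linear V -> V}) :
  (forall y z, D (y ** z) = D y ** z + y ** D z) ->
  forall x, eval_at (jtr r m) (D x) = 0.
Proof.
move=> DM; apply: regular_dense => [x d|x reg].
  exists (eval_at (jtr r m) (D d)).
  apply: dpoly_eq (dpoly_affine (eval_at (jtr r m) (D x)) (eval_at (jtr r m) (D d))) _ => t.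
  by rewrite addrC [x + _]addrC linearP jtr_linear.
have [b hb] : exists b : nat -> R, forall j,
    dpoly (fun t => (minpoly_at (x + t *: D x))`_j) (b j).
  have := @boolp.choice nat R
    (fun j b => dpoly (fun t => (minpoly_at (x + t *: D x))`_j) b).
  case=> [j|b hb]; last by exists b.
  exact: linepoly_coef.
have sum0 : \sum_(j < r.+1) (b j *: jpow J x j + (minpoly_at x)`_j *: D (jpow J x j)) = 0.
  apply/rowP => k; rewrite summxE mxE.
  have h j : dpoly (fun t => (minpoly_at (x + t *: D x))`_j * jpow J (x + t *: D x) j 0 k)
      ((b j *: jpow J x j + (minpoly_at x)`_j *: D (jpow J x j)) 0 k).
    have [q hq hqb] := dpolyM (hb j) (dpoly_jpow x j k DM).
    by exists q => //; rewrite hqb !mxE scale0r addr0.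
  apply: (dpoly_uniq (dpoly_sum (index_enum 'I_r.+1) (fun j : 'I_r.+1 => h j))).
  apply: dpoly_eq (dpoly_cst 0) _ => t.
  have /rowP/(_ k) := minpoly_at_annul (x + t *: D x); rewrite summxE mxE => h0; rewrite -[LHS]h0.
  by apply: eq_bigr => j _; rewrite mxE.
have br : b r = 0.
  apply: (dpoly_uniq (hb r)); apply: dpoly_eq (dpoly_cst 1) _ => t.
  by rewrite minpoly_at_coefr.
have b0 : \poly_(j < r) b j = 0.
  apply: reg; first exact: size_poly.
  rewrite (jhornerE J x (size_poly _ _)); move: sum0; rewrite big_split /=.
  under [X in _ + X]eq_bigr do rewrite -linearZ.
  rewrite -linear_sum minpoly_at_annul linear0 addr0 big_ord_recr /= br scale0r addr0.
  by move=> h; rewrite -[RHS]h; apply: eq_bigr => j _; rewrite coef_poly ltn_ord.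
rewrite jtrE; have <- : b r.-1 = (minpoly_at (D x))`_r.-1.
  apply: (dpoly_uniq (hb r.-1)).
  apply: dpoly_eq (dpoly_affine (minpoly_at x)`_r.-1 (minpoly_at (D x))`_r.-1) _ => t.
  apply: oppr_inj; rewrite -jtrE addrC [x + _]addrC jtr_linear !jtrE.
  by rewrite opprD mulrN.
have := congr1 (fun p : {poly R} => p`_r.-1) b0.
by rewrite coef_poly coef0 prednK // leqnn => ->; rewrite oppr0.
Qed.

End GenericMinimalPolynomial.

(** * Nondegeneracy of the trace form *)

Section TraceForm.
Variables (R : realType) (n r : nat) (J : jordanAlgebra R n).
Local Notation V := 'rV[R]_n.
Local Notation "x ** y" := (jmul J x y) (at level 40, left associativity).
Local Notation e := (jone J).

Lemma jcomm_linear a b : linear (jcomm J a b).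
Proof.
by move=> c x y; rewrite /jcomm !(jmulDr, jmulZr) opprD addrACA scalerBr.
Qed.

HB.instance Definition _ a b :=
  GRing.isLinear.Build R V V *:%R (jcomm J a b) (jcomm_linear a b).

Hypothesis hr : has_rank J r.
Variable m : {poly {mpoly R[n]}}.
Hypothesis hm : is_generic_minpoly J r m.
Hypothesis hJ : simple_jordan J.

Lemma jone_neq0 : e != 0.
Proof.
have [n0 _] := hJ; apply/eqP => e0.
pose v : V := delta_mx 0 (Ordinal n0).
have : v = 0 by rewrite -(jmul1 J v) e0 jmulC jmul0r.
by move/rowP/(_ (Ordinal n0)); rewrite !mxE !eqxx => /eqP; rewrite oner_eq0.
Qed.

Lemma rank_gt0 : (0 < r)%N.
Proof.
have [[x [p [[pm px _] sp]]] _] := hr; rewrite lt0n; apply/eqP => r0.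
move: sp; rewrite r0 => sp; have pC := size1_polyC (eq_leq sp).
have p1 : p`_0 = 1 by move/monicP: pm; rewrite lead_coefE sp.
move: px; rewrite pC p1 jhornerC scale1r => /eqP.
by rewrite (negbTE jone_neq0).
Qed.

Local Notation tr := (eval_at (jtr r m)).
Local Notation t := (tau J r m).

(** The difference of the two sides is the trace of an inner derivation. *)
Lemma tau_assoc a x y : t (a ** x) y = t x (a ** y).
Proof.
have h : tr (jcomm J y x a) = 0.
  apply: (jtr_derivation hr hm rank_gt0) => u v; exact: jcomm_derivation.
move: h; rewrite /jcomm -scaleN1r addrC (jtr_linear hr hm rank_gt0) => h.
rewrite /tau (jmulC J (a ** x)) (jmulC J a x) (jmulC J a y).
by lra.
Qed.

Lemma tau_linearr x c y z : t x (c *: y + z) = c * t x y + t x z.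
Proof. by rewrite /tau jmulDr jmulZr (jtr_linear hr hm rank_gt0). Qed.

Lemma tau_linearl x c y z : t (c *: y + z) x = c * t y x + t z x.
Proof. by rewrite /tau jmulDl jmulZl (jtr_linear hr hm rank_gt0). Qed.

Lemma tau_gram x y : t x y = \sum_j (x *m gram J r m) 0 j * y 0 j.
Proof.
have t0r u : t u 0 = 0.
  by have := tau_linearr u 1 0 0; rewrite scaler0 add0r mul1r; lra.
have t0l u : t 0 u = 0 by rewrite -(t0r u) /tau jmulC.
have tsr u (s : seq 'I_n) : t u (\sum_(j <- s) y 0 j *: delta_mx 0 j) =
    \sum_(j <- s) y 0 j * t u (delta_mx 0 j).
  by elim: s => [|j s ih]; rewrite ?big_nil // !big_cons tau_linearr ih.
have tsl u (s : seq 'I_n) : t (\sum_(j <- s) x 0 j *: delta_mx 0 j) u =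
    \sum_(j <- s) x 0 j * t (delta_mx 0 j) u.
  by elim: s => [|j s ih]; rewrite ?big_nil // !big_cons tau_linearl ih.
rewrite {1}(row_sum_delta y) tsr; apply: eq_bigr => j _; rewrite mulrC; congr (_ * _).
rewrite {1}(row_sum_delta x) tsl mxE; apply: eq_bigr => i _.
by rewrite mxE.
Qed.

(** By associativity the radical of the trace form is an ideal, and it is not the
    whole algebra because tr(e) = r is nonzero. *)
Lemma gram_unit : gram J r m \in unitmx.
Proof.
pose f := linfun (mulmxr (gram J r m) : V -> V).
have fE (x : V) : f x = x *m gram J r m by rewrite lfunE.
have idl x y : y \in lker f -> x ** y \in lker f.
  rewrite !memv_ker !fE => /eqP y0; apply/eqP/rowP => j; rewrite mxE.
  have : t (x ** y) (delta_mx 0 j) = 0.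
    by rewrite tau_assoc tau_gram y0 big1 // => i _; rewrite mxE mul0r.
  rewrite tau_gram (bigD1 j) //= big1 ?addr0 => [|i ij]; first by rewrite !mxE !eqxx mulr1.
  by rewrite [X in _ * X]mxE (negbTE ij) andbF mulr0.
have [_ /(_ _ idl) [ker0|kerT]] := hJ.
  rewrite -row_free_unit -kermx_eq0; apply/eqP/row_matrixP => i; rewrite row0.
  apply/eqP; rewrite -memv0 -ker0 memv_ker fE -row_mul mulmx_ker row0 //.
have : e \in lker f by rewrite kerT memvf.
rewrite memv_ker fE => /eqP e0.
have : t e e = 0 by rewrite tau_gram e0 big1 // => i _; rewrite mxE mul0r.
rewrite /tau jmul1 (jtr_one hr hm rank_gt0) => /eqP; rewrite pnatr_eq0 => /eqP r0.
by have := rank_gt0; rewrite r0.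
Qed.

Lemma dual_det_one : dual_det J r m (e *m gram J r m) = 1.
Proof. by rewrite /dual_det mulmxK ?gram_unit // (jdet_one hr hm). Qed.

End TraceForm.

(** * The determinants of the two components, and the theorem *)

Section Determinants.
Variables (R : realType) (n r : nat) (J : jordanAlgebra R n).
Variable m : {poly {mpoly R[n]}}.

Lemma eval_linear_poly N (A : 'M[R]_(N, n)) (p : {mpoly R[n]}) :
  exists d : {mpoly R[i][N]}, forall w, (eval_at p (w *m A))%:C = d.@[ptC w].
Proof.
elim/mpoly_closure: p => [c|i|p q [d hd] [d' hd']|p q [d hd] [d' hd']].
- by exists (c%:C)%:MP => w; rewrite /eval_at !mevalC.
- exists (\sum_j (A j i)%:C *: 'X_j) => w; rewrite /eval_at mevalXU mxE.
  rewrite (raddf_sum (meval _)) rmorph_sum /=; apply: eq_bigr => j _.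
  by rewrite mevalZ mevalXU rmorphM mulrC.
- exists (d + d') => w; rewrite mevalD -hd -hd' /eval_at mevalD.
  exact: rmorphD.
- exists (d * d') => w; rewrite mevalM -hd -hd' /eval_at mevalM.
  exact: rmorphM.
Qed.

Definition ldet (w : 'rV[R]_(n + n)) := dual_det J r m (lsubmx w).
Definition rdet (w : 'rV[R]_(n + n)) := dual_det J r m (rsubmx w).

Lemma ldet_poly : exists d : {mpoly R[i][n + n]}, forall w, (ldet w)%:C = d.@[ptC w].
Proof.
pose A : 'M[R]_(n + n, n) := col_mx 1%:M 0.
have [d hd] := eval_linear_poly (A *m invmx (gram J r m)) (jdet r m).
exists d => w; rewrite -hd mulmxA -{2}[w]hsubmxK mul_row_col mulmx1 mulmx0 addr0.
by [].
Qed.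

Lemma rdet_poly : exists d : {mpoly R[i][n + n]}, forall w, (rdet w)%:C = d.@[ptC w].
Proof.
pose A : 'M[R]_(n + n, n) := col_mx 0 1%:M.
have [d hd] := eval_linear_poly (A *m invmx (gram J r m)) (jdet r m).
exists d => w; rewrite -hd mulmxA -{2}[w]hsubmxK mul_row_col mulmx1 mulmx0 add0r.
by [].
Qed.

Lemma open_pos_poly N (f : 'rV[R]_N -> R) (d : {mpoly R[i][N]}) :
  (forall w, (f w)%:C = d.@[ptC w]) -> open [set w | 0 < f w]%classic.
Proof.
move=> fd; have -> : f = fun w : 'rV[R]_N => complex.Re d.@[ptC w].
  by apply/funext => w; rewrite -fd.
pose g (w : 'rV[R]_N) : R := complex.Re d.@[ptC w].
have cg : {in g @^-1` [set x | x > 0], continuous g}%classic.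
  by move=> w _; apply: differentiable_continuous; have [] := differentiable_poly d w.
exact: (open_comp cg (@open_gt R 0)).
Qed.

End Determinants.

Lemma spow_pos (R : realType) (t : R) (s : R[i]) (b : bool) : 0 < t -> spow t s b = cpow t s.
Proof.
by move=> t0; rewrite /spow gtr0_sg // gtr0_norm //; case: b; rewrite mul1r.
Qed.

Lemma source_iterE (R : realType) (n : nat) (F : R[i] -> R[i] -> weyl R (n + n))
    k lambda mu f :
  source_iter F k lambda mu f = source_comp (fun j => F (lambda + j%:R) (mu + j%:R)) k f.
Proof. by elim: k => //= k ->. Qed.

Theorem proposition4p2 (R : realType) (n r : nat) (J : jordanAlgebra R n)
  (hJ : simple_jordan J) (hr : has_rank J r)
  (m : {poly {mpoly R[n]}}) (hm : is_generic_minpoly J r m)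
  (D F : R[i] -> R[i] -> weyl R (n + n))
  (hD : is_D J r m D) (hF : is_source r D F)
  (lambda mu : R[i]) (k : nat)
  (c : {mpoly R[i][n + n]})
  (hc : is_c J r m k (lambda - n_over_r R n r) (mu - n_over_r R n r) c)
  (b : 'rV[R]_n -> 'rV[R]_n -> R[i]) (hb : is_b F k lambda mu b)
  (xi zeta : 'rV[R]_n) :
  b xi zeta =
  ('i%C)^-1 ^+ (r * k) * c.@[fun i => (row_mx xi zeta 0 i)%:C].
Proof.
have [d1 d1E] := ldet_poly r J m; have [d2 d2E] := rdet_poly r J m.
pose Om := Omega (ldet r J m) (rdet r J m).
have openOm : open Om := openI (open_pos_poly d1E) (open_pos_poly d2E).
set s := lambda - _ in hc; set t := mu - _ in hc.
pose Dk (j : nat) := D (s + j%:R + 1) (t + j%:R + 1).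
(* At x = 0 the wave is 1, and b is the value of the bidifferential operator. *)
have bE z : b (lsubmx z) (rsubmx z) = compose_ops Dk k (fun=> 1) z.
  have := hb 0 (lsubmx z) (rsubmx z).
  rewrite /bidiff source_iterE hsubmxK row_mx0 wave0 mulr1 => <-.
  apply: symbol_duality => j w u.
  have := hF (lambda + j%:R) (mu + j%:R) (lsubmx w) (rsubmx w) (lsubmx u) (rsubmx u).
  rewrite !hsubmxK => ->; rewrite /Dk /s /t.
  by rewrite [lambda + _ - _]addrAC [mu + _ - _]addrAC.
have [h hE] := compose_ops_poly Dk k.
pose A : cfun R (n + n) -> cfun R (n + n) :=
  subst_op (jdet r m) (scaled_deriv ('i%C)^-1).
pose pw := powers (ldet r J m) (rdet r J m).
have [Dpoly Dgen] := hD.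
have [G genG GD] := Dgen true true.
(* Where the determinants are positive, the powers of both signs are [cpow]. *)
have inter : forall s t (q : {mpoly R[i][n + n]}),
    eqOmega (ldet r J m) (rdet r J m) (A (fun w => pw s t w * q.@[ptC w]))
      (fun w => pw (s - 1) (t - 1) w * diffop (D s t) (fun u => q.@[ptC u]) w).
  apply: (intertwining_extend d1E d2E openOm Dpoly genG) => s' t' Gst phi sphi w Ow.
  have [w1 w2] := Ow.
  have := GD s' t' Gst phi sphi (lsubmx w) (rsubmx w).
  rewrite !gt_eqF // hsubmxK !spow_pos // => /(_ isT isT) <-.
  have lA : local_op (ldet r J m) (rdet r J m) A.
    by apply: local_subst_op => i; apply: local_scaled_deriv.
  by apply: lA => // u [u1 u2]; rewrite /pw /powers !spow_pos.
have onOm w : Om w -> ('i%C)^-1 ^+ (r * k) * c.@[ptC w] = h.@[ptC w].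
  move=> Ow; have := intertwining_iter openOm inter s t k Ow; rewrite -/Dk hE.
  have := proportional_det d1E d2E openOm ('i%C)^-1 k (s + k%:R) (t + k%:R)
    (jdet_homog hr hm) Ow.
  rewrite -/A => -> .
  have [w1 w2] := Ow; have := hc (lsubmx w) (rsubmx w) w1 w2; rewrite hsubmxK.
  rewrite -/(powers (ldet r J m) (rdet r J m) s t w) => cE.
  move=> e; apply: (mulfI (powers_neq0 (ldet r J m) (rdet r J m) s t w)).
  rewrite -e mulrCA; congr (_ * _); rewrite mulrC; exact: esym cE.
(* The linear form tau(., e) is the vector e *m gram. *)
have Om0 : exists w, Om w.
  exists (row_mx (jone J *m gram J r m) (jone J *m gram J r m)).
  by rewrite /Om /Omega /= /ldet /rdet row_mxKl row_mxKr (dual_det_one hr hm hJ).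
have ph : ('i%C)^-1 ^+ (r * k) *: c - h = 0.
  apply: (poly_open_eq0 openOm Om0) => w Ow.
  by rewrite mevalB mevalZ onOm // subrr.
have := bE (row_mx xi zeta); rewrite row_mxKl row_mxKr hE => ->.
by rewrite -[h](subrK (('i%C)^-1 ^+ (r * k) *: c)) -opprB ph oppr0 add0r mevalZ.
Qed.
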